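(* Let $n=1$, let $M\ge 0$ be real and let $t_0\in\mathbb R$. Let $\mathcal E_+(x,t;0,t_0)$ be the function on $\mathbb R^2$ equal to $E(x,t;0,t_0)$ on $D_+(0,t_0)$ and $0$ elsewhere, and let $\mathcal E_-(x,t;0,t_0)$ be the function equal to $E(x,t;0,t_0)$ on $D_-(0,t_0)$ and $0$ elsewhere, where $E$ and $D_\pm$ are defined in the context. Then, regarded as distributions on $\mathbb R^2$ in the variables $(x,t)$, $\mathcal E_+(\cdot,\cdot;0,t_0)$ and $\mathcal E_-(\cdot,\cdot;0,t_0)$ are fundamental solutions of $\mathcal S=\partial_t^2-e^{-2t}\partial_x^2+M^2$ relative to the point $(0,t_0)$, that is, $$\frac{\partial^2}{\partial t^2}\mathcal E_\pm(x,t;0,t_0)-e^{-2t}\frac{\partial^2}{\partial x^2}\mathcal E_\pm(x,t;0,t_0)+M^2\mathcal E_\pm(x,t;0,t_0)=\delta(x,t-t_0).$$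
   Context: $F(a,b;c;\zeta)$ denotes the Gauss hypergeometric function. For $(x_0,t_0)\in\mathbb R\times\mathbb R$, $$D_\pm(x_0,t_0):=\{(x,t)\in\mathbb R^{2}:\ |x-x_0|\le \pm(e^{-t_0}-e^{-t})\},$$ and on $D_+(x_0,t_0)\cup D_-(x_0,t_0)$ $$E(x,t;x_0,t_0)=(4e^{-t_0-t})^{iM}\big((e^{-t}+e^{-t_0})^2-(x-x_0)^2\big)^{-\frac12-iM}F\Big(\tfrac12+iM,\tfrac12+iM;1;\frac{(e^{-t_0}-e^{-t})^2-(x-x_0)^2}{(e^{-t_0}+e^{-t})^2-(x-x_0)^2}\Big),$$ where complex powers of positive numbers are given by $r^{w}=e^{w\ln r}$. On this set the argument of $F$ lies in $[0,1)$. The functions $\mathcal E_\pm$ are locally integrable, hence define distributions. *)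

(* Defs.v *)
From HB Require Import structures.
From mathcomp Require Import all_boot all_order all_algebra.
From mathcomp Require Import complex.
From mathcomp Require Import all_classical all_reals all_analysis.

Set Implicit Arguments.
Unset Strict Implicit.
Unset Printing Implicit Defensive.

Import Order.TTheory GRing.Theory Num.Theory.
Import numFieldNormedType.Exports.

Local Open Scope classical_set_scope.
Local Open Scope ring_scope.
Local Open Scope complex_scope.

Local Notation Re := complex.Re.
Local Notation Im := complex.Im.

Section Hypergeometric.
Context {R : realType}.
Implicit Types (a b c w z : R[i]) (r : R).

Definition cexp w : R[i] :=
  (expR (Re w))%:C * (cos (Im w) +i* sin (Im w)).

(* [r ^ w] for [r > 0] *)
Definition cpow r w : R[i] := cexp (w * (ln r)%:C).

(* rising factorial [(a)_n = a (a + 1) ... (a + n - 1)] *)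
Definition poch a n : R[i] := \prod_(i < n) (a + i%:R).

(* Gauss series; meaningful for [`|z| < 1] and [c] not a nonpositive integer.
   [R[i]^o] carries the topology of the modulus. *)
Definition hyp2F1 a b c z : R[i] :=
  limn (series (fun n : nat =>
    poch a n * poch b n / (poch c n * n`!%:R) * z ^+ n) : nat -> R[i]^o).

End Hypergeometric.

Section Distributions.
Context {R : realType}.

(* Points of the plane are pairs [(x, t)]. *)
Definition ex : R * R := (1, 0).
Definition et : R * R := (0, 1).

(* Iterated partial derivatives; [true] stands for d/dt, [false] for d/dx. *)
Definition pderiv (s : seq bool) (f : R * R -> R) : R * R -> R :=
  foldr (fun b g => 'D_(if b then et else ex) g) f s.

Definition smooth (f : R * R -> R) : Prop :=
  forall s z, [/\ {for z, continuous (pderiv s f)},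
                  derivable (pderiv s f) z ex & derivable (pderiv s f) z et].

Definition test_function (phi : R * R -> R[i]) : Prop :=
  [/\ smooth (fun z => Re (phi z)), smooth (fun z => Im (phi z)) &
      compact (closure [set z | phi z != 0])].

Definition cderive (v : R * R) (phi : R * R -> R[i]) : R * R -> R[i] :=
  fun z => 'D_v (fun y => Re (phi y)) z +i* 'D_v (fun y => Im (phi y)) z.

(* Functionals are total on all functions, but only their values on test
   functions are ever constrained. *)
Definition functional := (R * R -> R[i]) -> R[i].

Definition distribution (T : functional) : Prop :=
  [/\ forall phi psi, test_function phi -> test_function psi ->
        T (fun z => phi z + psi z) = T phi + T psi,
      forall (c : R[i]) phi, test_function phi ->
        T (fun z => c * phi z) = c * T phi &
      forall K : set (R * R), compact K ->
        exists (N : nat) (C : R), forall (phi : R * R -> R[i]) (B : R),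
          test_function phi -> (forall z, ~ K z -> phi z = 0) ->
          (forall s z, (size s <= N)%N ->
             `|pderiv s (fun y => Re (phi y)) z| <= B /\
             `|pderiv s (fun y => Im (phi y)) z| <= B) ->
          `|T phi| <= (C * B)%:C].

Definition deriv_dist (v : R * R) (T : functional) : functional :=
  fun phi => - T (cderive v phi).

Definition mul_dist (g : R * R -> R) (T : functional) : functional :=
  fun phi => T (fun z => (g z)%:C * phi z).

Definition delta (p : R * R) : functional := fun phi => phi p.

Local Notation mu2 := (@lebesgue_measure R \x @lebesgue_measure R)%E.

Definition loc_integrable (f : R * R -> R[i]) : Prop :=
  forall K : set (R * R), compact K ->
    mu2.-integrable K (fun z => (Re (f z))%:E) /\
    mu2.-integrable K (fun z => (Im (f z))%:E).

Definition cintegral (f : R * R -> R[i]) : R[i] :=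
  Rintegral mu2 setT (fun z => Re (f z)) +i*
  Rintegral mu2 setT (fun z => Im (f z)).

Definition dist_of_fun (f : R * R -> R[i]) : functional :=
  fun phi => cintegral (fun z => f z * phi z).

End Distributions.

Section KleinGordon.
Context {R : realType}.

Definition Dplus (x0 t0 : R) : set (R * R) :=
  [set z | `|z.1 - x0| <= expR (- t0) - expR (- z.2)].

Definition Dminus (x0 t0 : R) : set (R * R) :=
  [set z | `|z.1 - x0| <= - (expR (- t0) - expR (- z.2))].

Definition E (M : R) (z : R * R) (x0 t0 : R) : R[i] :=
  let x := z.1 in
  let t := z.2 in
  let num := (expR (- t0) - expR (- t)) ^+ 2 - (x - x0) ^+ 2 in
  let den := (expR (- t0) + expR (- t)) ^+ 2 - (x - x0) ^+ 2 in
  let iM : R[i] := 0 +i* M in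
  let a : R[i] := 2^-1 + iM in
  cpow (4 * expR (- t0 - t)) iM * cpow den (- a) * hyp2F1 a a 1 (num / den)%:C.

Definition Eplus (M x0 t0 : R) (z : R * R) : R[i] :=
  if z \in Dplus x0 t0 then E M z x0 t0 else 0.

Definition Eminus (M x0 t0 : R) (z : R * R) : R[i] :=
  if z \in Dminus x0 t0 then E M z x0 t0 else 0.

(* [d^2/dt^2 - e^{-2t} d^2/dx^2 + M^2] *)
Definition KG (M : R) (T : functional) : functional := fun phi =>
  deriv_dist et (deriv_dist et T) phi
  - mul_dist (fun z : R * R => expR (- 2 * z.2))
      (deriv_dist ex (deriv_dist ex T)) phi
  + (M ^+ 2)%:C * T phi.

Definition fundamental_solution (M : R) (p : R * R) (T : functional) : Prop :=
  distribution T /\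
  forall phi, test_function phi -> KG M T phi = delta p phi.

End KleinGordon.

(* Main.v *)
(* In the coordinates [s = e^-t], [s0 = e^-t0], Pfaff's transformation turns the kernel into
   [E = h(t) G(w)] with [h = (4 s0 s)^(-1/2)], [w = ((s0 - s)^2 - x^2) / (4 s0 s)] and
   [G(w) = (1 + w)^(-a) F(a, a; 1; w / (1 + w))], [a = 1/2 + iM].  The hypergeometric equation
   becomes [w (1 + w) G'' + (1 + 2 w) G' + (1/4 + M^2) G = 0], whose coefficients are real, so
   the real and imaginary parts of [G] can be treated separately.  For a real solution [g],
   [u = h g(w)] solves the Klein-Gordon equation.  Parametrising the light cone by
   [x = (s0 - s) y], [-1 <= y <= 1], Green's identity writes [(s0 - s) u (S phi)] as a divergence
   on a rectangle in [(y, t)]; on the two characteristics [y = 1, -1], where [w = 0], the flux is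
   the total [t]-derivative of [s h g(0) phi], which integrates to [g(0) phi(0, t0)]. *)
From HB Require Import structures.
From mathcomp Require Import all_boot all_order all_algebra.
From mathcomp Require Import complex.
From mathcomp Require Import all_classical all_reals all_analysis.
From mathcomp Require Import measurable_realfun ring lra.
Require Import Defs.

Set Implicit Arguments.
Unset Strict Implicit.
Unset Printing Implicit Defensive.

Import Order.TTheory GRing.Theory Num.Theory.
Import numFieldNormedType.Exports.

Local Open Scope classical_set_scope.
Local Open Scope ring_scope.

(** * Integration on the plane *)

(** The obstacle is the apex of the cone: its slices shrink to a point there, so integrating by
    parts on the cone itself would mean moving endpoints and an excised neighbourhood of the source.
    Rescaling every slice to [[-1, 1]] gives a fixed rectangle and blows the apex up into an edge,
    on which the flux carries the vanishing Jacobian [s0 - s]; only the characteristic edges are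
    left. They meet at the apex, each contributes one half through [2 s0 h(t0) = 1], and [G(0) = 1]
    gives the delta its unit mass. The Jacobian is negative in the past, and this sign compensates
    the apex being the last time instead of the first, so one identity serves both cones. The
    operator can be moved onto the test function unchanged because [e^{-2t}] does not depend on [x].
    Finally, [|w / (1 + w)| < 1] holds as soon as [w > -1/2]: the profile continues smoothly past
    the boundary value [w = 0] of the cone, and ordinary two-sided derivatives are available
    there. *)

Section PlaneMeasure.
Context {R : realType}.
Local Notation mu := (@lebesgue_measure R).
Local Notation mu2 := (@lebesgue_measure R \x @lebesgue_measure R)%E.
Implicit Types (A K : set (R * R)) (f g : R * R -> R).

(** The product sigma-algebra is generated by rectangles, so openness yields measurability through
    second countability: an open set is the countable union of the boxes with rational centre and
    radius [1/(n+1)] that it contains. *)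
Lemma open_measurable_prod A : open A -> measurable A.
Proof.
move=> oA.
pose box (p q : rat) (n : nat) : set (R * R) :=
  ball (ratr p : R) (n.+1%:R^-1) `*` ball (ratr q : R) (n.+1%:R^-1).
have mbox p q n : measurable (box p q n).
  by apply: measurableX; apply: open_measurable; exact: ball_open.
have -> : A = \bigcup_(p : rat) \bigcup_(q : rat)
    \bigcup_(n in [set n | box p q n `<=` A]) box p q n.
  apply/seteqP; split; last by move=> z [p _] [q _] [n /= nA] /nA.
  move=> [x t] /= Axt.
  have /nbhs_ballP[e /= e0 eA] := open_nbhs_nbhs (conj oA Axt).
  (* The radius is at most [e / 2]: a box whose centre is within [d] of the point then stays within
     [d + d <= e] of it. *)
  have [n _ hn] := near_infty_natSinv_lt (PosNum (divr_gt0 e0 (@ltr0n R 2))).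
  pose d : R := n.+1%:R^-1.
  have d0 : 0 < d by rewrite invr_gt0.
  have de : d + d <= e by rewrite (splitr e) lerD// ltW//; exact: (hn n (leqnn n)).
  have near_rat (y : R) : exists r : rat, `|ratr r - y| < d.
    have : y - d < y + d by rewrite ltrBlDr -addrA ltrDl addr_gt0.
    move=> /rat_in_itvoo[r]; rewrite in_itv /= => /andP[h1 h2].
    by exists r; rewrite ltr_distl h1 h2.
  have [[p hp] [q hq]] := (near_rat x, near_rat t).
  exists p => //; exists q => //; exists n => /=; last by split.
  move=> [x' t'] [/= hx ht]; apply: eA; split => /=.
  - rewrite /ball/= in hx *; apply: lt_le_trans de.
    by rewrite (le_lt_trans (ler_distD (ratr p) _ _))// ltrD// distrC.
  - rewrite /ball/= in ht *; apply: lt_le_trans de.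
    by rewrite (le_lt_trans (ler_distD (ratr q) _ _))// ltrD// distrC.
apply: bigcupT_measurable_rat => p; apply: bigcupT_measurable_rat => q.
exact: bigcup_measurable.
Qed.

Lemma closed_measurable_prod A : closed A -> measurable A.
Proof. by move/closed_openC/open_measurable_prod/measurableC; rewrite setCK. Qed.

Lemma compact_measurable_prod K : compact K -> measurable K.
Proof.
move=> /compact_closed cK; apply: closed_measurable_prod; apply: cK.
exact: norm_hausdorff.
Qed.

Lemma continuous_measurable_prod f : continuous f -> measurable_fun setT f.
Proof.
move=> cf; apply: (measurability _ (RGenOpens.measurableE R)).
move=> _ [_ [a [b ->] <-]]; rewrite setTI; apply: open_measurable_prod.
by move/continuousP : cf; apply; exact: interval_open.
Qed.

Definition square (r : R) : set (R * R) := `[- r, r]%classic `*` `[- r, r]%classic.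

Lemma square_compact r : compact (square r).
Proof. by apply: compact_setX; exact: segment_compact. Qed.

Lemma squareP r (z : R * R) : square r z <-> `|z.1| <= r /\ `|z.2| <= r.
Proof.
rewrite /square /= !in_itv /= -!ler_norml; split => -[]//.
Qed.

Lemma square_measurable r : measurable (square r).
Proof. by apply: measurableX. Qed.

Lemma square_mu_lty r : (mu2 (square r) < +oo)%E.
Proof.
have lt1 : (mu [set` `[- r, r]%R] < +oo)%E.
  by rewrite lebesgue_measure_itv /=; case: ifPn => _; rewrite ?ltry.
by rewrite product_measure1E//; apply: lte_mul_pinfty => //; apply/fin_numPlt;
  rewrite lt1 (lt_le_trans _ (measure_ge0 _ _)).
Qed.

Lemma compact_subset_square K : compact K -> exists2 r, 0 < r & K `<=` square r.
Proof.
move=> /compact_bounded[N [_ hN]]; exists (`|N| + 1); first by rewrite ltr_wpDl.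
move=> z Kz; apply/squareP.
have : `|z| <= `|N| + 1.
  by apply: (hN (`|N| + 1)) => //; rewrite (le_lt_trans (ler_norm _)) ?ltrDl.
by rewrite prod_normE /= ge_max => /andP[].
Qed.

Lemma bounded_support_integrable f r C : measurable_fun setT f ->
  (forall z, `|f z| <= C) -> (forall z, ~ square r z -> f z = 0) ->
  mu2.-integrable setT (EFin \o f).
Proof.
move=> mf fC f0.
have -> : (EFin \o f) = (EFin \o f) \_ (square r).
  apply/funext => z; rewrite patchE; case: ifPn => //.
  by rewrite notin_setE => /f0 /= ->.
apply: (integrable_mkcond _ _).1; first exact: square_measurable.
apply: measurable_bounded_integrable => //.
- exact: square_measurable.
- exact: square_mu_lty.
- exact: measurable_funTS.
- by exists C; split; [exact: num_real|move=> x Cx z _ /=; exact: (le_trans (fC z) (ltW Cx))].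
Qed.

(** Every slice is assumed integrable, not almost every one: [Rintegral] passes through [fine],
    which is faithful only when the inner integral is finite. *)
Lemma Rintegral_prod12 f : mu2.-integrable setT (EFin \o f) ->
  (forall x, mu.-integrable setT (fun t => (f (x, t))%:E)) ->
  Rintegral mu2 setT f = Rintegral mu setT (fun x => Rintegral mu setT (fun t => f (x, t))).
Proof.
move=> intf intf1; rewrite /Rintegral -integral12_prod_meas1//.
congr fine; apply: eq_integral => x _.
by rewrite fineK//; apply: integrable_fin_num.
Qed.

Lemma Rintegral_prod21 f : mu2.-integrable setT (EFin \o f) ->
  (forall t, mu.-integrable setT (fun x => (f (x, t))%:E)) ->
  Rintegral mu2 setT f = Rintegral mu setT (fun t => Rintegral mu setT (fun x => f (x, t))).
Proof.
move=> intf intf1; rewrite /Rintegral -integral21_prod_meas1//.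
congr fine; apply: eq_integral => x _.
by rewrite fineK//; apply: integrable_fin_num.
Qed.

End PlaneMeasure.

(** * Continuity, the fundamental theorem of calculus and Fubini on rectangles *)

Section Calculus.
Context {R : realType}.
Local Notation mu := (@lebesgue_measure R).
Implicit Types (f g : R * R -> R).

Section Continuity.
Context {T : topologicalType}.
Implicit Types (u v : T -> R).

Lemma contD u v : continuous u -> continuous v -> continuous (fun z => u z + v z).
Proof. by move=> cu cv z; apply: cvgD; [exact: cu|exact: cv]. Qed.

Lemma contB u v : continuous u -> continuous v -> continuous (fun z => u z - v z).
Proof. by move=> cu cv z; apply: cvgB; [exact: cu|exact: cv]. Qed.

Lemma contM u v : continuous u -> continuous v -> continuous (fun z => u z * v z).
Proof. by move=> cu cv z; apply: cvgM; [exact: cu|exact: cv]. Qed.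

Lemma contN u : continuous u -> continuous (fun z => - u z).
Proof. by move=> cu z; apply: cvgN; exact: cu. Qed.

Lemma contX u n : continuous u -> continuous (fun z => u z ^+ n).
Proof.
move=> cu z; elim: n => [|n IH]; first exact: cvg_cst.
under eq_fun do rewrite exprS.
by apply: cvgM; [exact: cu|exact: IH].
Qed.

Lemma cont1 {U : topologicalType} (h : R -> U) u : continuous h -> continuous u ->
  continuous (fun z => h (u z)).
Proof. by move=> ch cu z; apply: (continuous_comp (cu z)); exact: ch. Qed.

Lemma cont2 {U : topologicalType} (h : R * R -> U) u v : continuous h ->
  continuous u -> continuous v -> continuous (fun z => h (u z, v z)).
Proof.
move=> ch cu cv z; apply: (@continuous_comp _ _ _ (fun z => (u z, v z)) h).
  exact: (cvg_pair (cu z) (cv z)).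
exact: ch.
Qed.

Lemma cont_cst (r : R) : continuous (fun _ : T => r).
Proof. by move=> z; exact: cvg_cst. Qed.

End Continuity.

Lemma cont_fst : continuous (fun z : R * R => z.1).
Proof. by move=> z; exact: cvg_fst. Qed.

Lemma cont_snd : continuous (fun z : R * R => z.2).
Proof. by move=> z; exact: cvg_snd. Qed.

Lemma cont_id : continuous (fun x : R => x).
Proof. by move=> x; exact: cvg_id. Qed.

Lemma Rintegral_FTC (F f : R -> R) (a b : R) : a <= b -> continuous f ->
  (forall x : R, a <= x <= b -> is_derive x 1 F (f x)) ->
  Rintegral mu `[a, b] f = F b - F a.
Proof.
rewrite le_eqVlt => /predU1P[->|ab] cf dF.
  by rewrite set_itv1 Rintegral_set1 subrr.
have cF x : a <= x <= b -> {for x, continuous F}.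
  move=> /dF h; apply: differentiable_continuous; apply/derivable1_diffP.
  exact: ex_derive.
rewrite /Rintegral (@continuous_FTC2 _ f F)//.
- exact: continuous_subspaceT.
- split.
  + by move=> x; rewrite in_itv/= => /andP[/ltW ax /ltW xb];
      apply: (@ex_derive _ _ _ _ _ _ _ (dF x _)); rewrite ax xb.
  + by apply: cvg_at_right_filter; apply: cF; rewrite lexx ltW.
  + by apply: cvg_at_left_filter; apply: cF; rewrite lexx ltW.
- move=> x; rewrite in_itv/= => /andP[/ltW ax /ltW xb].
  by rewrite derive1E; apply: derive_val; apply: dF; rewrite ax xb.
Qed.

Lemma continuous_integrable_itv (f : R -> R) (a b : R) : continuous f ->
  mu.-integrable `[a, b] (EFin \o f).
Proof.
move=> cf; apply: continuous_compact_integrable; first exact: segment_compact.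
exact: continuous_subspaceT.
Qed.

Section Rectangle.
Variables (a b c d : R) (f : R * R -> R).
Hypothesis cf : continuous f.

Let rect : set (R * R) := `[a, b]%classic `*` `[c, d]%classic.

Let integrable_rect :
  (mu \x mu)%E.-integrable setT (EFin \o (f \_ rect)).
Proof.
have crect : compact rect by apply: compact_setX; exact: segment_compact.
have [r r0 rK] := compact_subset_square crect.
have /compact_bounded[N [_ hN]] : compact (f @` rect).
  by apply: continuous_compact => //; exact: continuous_subspaceT.
apply: (@bounded_support_integrable _ _ r (`|N| + 1)).
- apply/(measurable_restrictT _ _).1; first exact: compact_measurable_prod.
  by apply: measurable_funTS; exact: continuous_measurable_prod.
- move=> z; rewrite patchE; case: ifPn => [/set_mem zr|_].
    by apply: (hN (`|N| + 1)); [rewrite (le_lt_trans (ler_norm _)) ?ltrDl|exists z].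
  by rewrite normr0 addr_ge0.
- by move=> z zr; rewrite patchE; case: ifPn => // /set_mem /rK.
Qed.

Let slice1 x : mu.-integrable setT (fun t => ((f \_ rect) (x, t))%:E).
Proof.
rewrite (_ : (fun _ => _) = (fun t => ((\1_`[a, b] x) * f (x, t))%:E) \_ `[c, d]); last first.
  apply/funext => t; rewrite !patchE /rect indicE.
  by rewrite in_setX/=; case: (x \in _); case: (t \in _); rewrite /= ?mul1r ?mul0r.
apply: (integrable_mkcond _ _).1 => //; apply: continuous_integrable_itv.
by apply: contM; [exact: cont_cst|apply: cont2 => //; [exact: cont_cst|exact: cont_id]].
Qed.

Let slice2 t : mu.-integrable setT (fun x => ((f \_ rect) (x, t))%:E).
Proof.
rewrite (_ : (fun _ => _) = (fun x => ((\1_`[c, d] t) * f (x, t))%:E) \_ `[a, b]); last first.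
  apply/funext => x; rewrite !patchE /rect indicE.
  by rewrite in_setX/=; case: (x \in _); case: (t \in _); rewrite /= ?mul1r ?mul0r.
apply: (integrable_mkcond _ _).1 => //; apply: continuous_integrable_itv.
by apply: contM; [exact: cont_cst|apply: cont2 => //; [exact: cont_id|exact: cont_cst]].
Qed.

Let inner1 x : Rintegral mu setT (fun t => (f \_ rect) (x, t)) =
  ((fun x => Rintegral mu `[c, d] (fun t => f (x, t))) \_ `[a, b]) x.
Proof.
rewrite patchE [in RHS]Rintegral_mkcond.
case: ifPn => hx; first by apply: eq_Rintegral => t _; rewrite !patchE in_setX/= hx.
rewrite (_ : (fun _ => _) = cst 0) ?Rintegral_cst ?mul0r//.
by apply/funext => t; rewrite patchE in_setX/= (negbTE hx).
Qed.

Let inner2 t : Rintegral mu setT (fun x => (f \_ rect) (x, t)) =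
  ((fun t => Rintegral mu `[a, b] (fun x => f (x, t))) \_ `[c, d]) t.
Proof.
rewrite patchE [in RHS]Rintegral_mkcond.
case: ifPn => ht; first by apply: eq_Rintegral => x _; rewrite !patchE in_setX/= ht andbT.
rewrite (_ : (fun _ => _) = cst 0) ?Rintegral_cst ?mul0r//.
by apply/funext => x; rewrite patchE in_setX/= (negbTE ht) andbF.
Qed.

(** Extended by zero outside the rectangle, [f] is bounded with compact support, so Fubini on the
    plane applies; each integral over a full line is then the integral over a side, itself extended
    by zero. *)
Lemma Rintegral_rect_swap :
  Rintegral mu `[c, d] (fun t => Rintegral mu `[a, b] (fun x => f (x, t))) =
  Rintegral mu `[a, b] (fun x => Rintegral mu `[c, d] (fun t => f (x, t))).
Proof.
rewrite Rintegral_mkcond [RHS]Rintegral_mkcond.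
have := Rintegral_prod12 integrable_rect slice1.
rewrite (Rintegral_prod21 integrable_rect slice2).
under eq_Rintegral do rewrite inner2.
by under [in RHS]eq_Rintegral do rewrite inner1.
Qed.

(** The extension by zero of this function is a Fubini marginal, hence integrable; continuity of the
    parametric integral never has to be proved. *)
Lemma integrable_rect_slice :
  mu.-integrable `[a, b] (EFin \o (fun x => Rintegral mu `[c, d] (fun t => f (x, t)))).
Proof.
apply: (integrable_mkcond _ _).2 => //.
rewrite (_ : _ \_ _ = fubini_F mu (EFin \o (f \_ rect))); last first.
  apply/funext => x.
  transitivity (Rintegral mu setT (fun t => (f \_ rect) (x, t)))%:E.
    by rewrite inner1 !patchE; case: ifPn.
  rewrite /fubini_F /Rintegral fineK//.
  by have := integrable_fin_num measurableT (slice1 x); apply.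
exact: integrable_fubini_F.
Qed.

End Rectangle.

End Calculus.

(** * Partial derivatives *)

Section Partial.
Context {R : realType}.
Implicit Types (f : R * R -> R) (s : seq bool).

Lemma pderiv_cat s s' f : pderiv (s ++ s') f = pderiv s (pderiv s' f).
Proof. by rewrite /pderiv foldr_cat. Qed.

Lemma smooth_pderiv s f : smooth f -> smooth (pderiv s f).
Proof. by move=> sf s' z; rewrite -pderiv_cat; exact: sf. Qed.

Lemma smooth_continuous s f : smooth f -> continuous (pderiv s f).
Proof. by move=> sf z; have [] := sf s z. Qed.

Lemma is_derive_partial_x f (x t : R) : derivable f (x, t) ex ->
  is_derive x 1 (fun x => f (x, t)) ('D_ex f (x, t)).
Proof.
have E : (fun h : R => h^-1 *: ((f \o shift (x, t)) (h *: (ex : R * R)) - f (x, t))) =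
  (fun h : R => h^-1 *: (((fun x => f (x, t)) \o shift x) (h *: (1 : R)) - f (x, t))).
  apply/funext => h /=; congr (_ *: (f _ - _)).
  by congr (_, _); exact: (etrans (congr1 (+%R^~ _) (scaler0 _ _)) (add0r _)).
by move=> df; split; [rewrite /derivable -E|rewrite /derive -E].
Qed.

Lemma is_derive_partial_t f (x t : R) : derivable f (x, t) et ->
  is_derive t 1 (fun t => f (x, t)) ('D_et f (x, t)).
Proof.
have E : (fun h : R => h^-1 *: ((f \o shift (x, t)) (h *: (et : R * R)) - f (x, t))) =
  (fun h : R => h^-1 *: (((fun t => f (x, t)) \o shift t) (h *: (1 : R)) - f (x, t))).
  apply/funext => h /=; congr (_ *: (f _ - _)).
  by congr (_, _); exact: (etrans (congr1 (+%R^~ _) (scaler0 _ _)) (add0r _)).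
by move=> df; split; [rewrite /derivable -E|rewrite /derive -E].
Qed.

(** [smooth] supplies partial derivatives along the axes and their continuity, not a Fréchet
    derivative. The increment is therefore cut into a move in the first variable, treated by the
    mean value theorem and continuity of the partial derivative, and a move in the second at fixed
    [a x], where the one-variable chain rule applies. *)
Lemma is_derive_comp2 f (a b : R -> R) (x da db : R) : smooth f ->
  is_derive x 1 a da -> is_derive x 1 b db ->
  is_derive x 1 (fun y => f (a y, b y))
    (pderiv [:: false] f (a x, b x) * da + pderiv [:: true] f (a x, b x) * db).
Proof.
move=> sf Da Db.
have fx (z t : R) : is_derive z 1 (fun z => f (z, t)) (pderiv [:: false] f (z, t)).
  by case: (sf [::] (z, t)) => _ h _; exact: (is_derive_partial_x h).
have ft : is_derive x 1 (fun y => f (a x, b y)) (pderiv [:: true] f (a x, b x) * db).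
  apply: (is_derive1_comp (f := fun t => f (a x, t))).
  by apply: is_derive_partial_t; have [] := sf [::] (a x, b x).
have mvt (u v t : R) : exists c, `|c - u| <= `|v - u| /\
    f (v, t) - f (u, t) = pderiv [:: false] f (c, t) * (v - u).
  have cfx (p q : R) : {within `[p, q], continuous (fun z => f (z, t))}.
    apply: continuous_subspaceT; apply: cont2; [|exact: cont_id|exact: cont_cst].
    exact: (@smooth_continuous [::]).
  case: (leP u v) => [uv|/ltW vu].
    have [c /[!in_itv]/= /andP[uc cv] E] :=
      MVT_segment uv (fun z _ => fx z t) (cfx _ _).
    by exists c; split => //; rewrite !ger0_norm ?subr_ge0// lerB.
  have [c /[!in_itv]/= /andP[uc cv] E] :=
    MVT_segment vu (fun z _ => fx z t) (cfx _ _).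
  exists c; split; first by rewrite !ler0_norm ?subr_le0// lerN2 lerB.
  by rewrite -opprB E -mulrN opprB.
(* [c h] is a mean value point between [a x] and [a (h + x)]; being no farther from [a x] than
   [a (h + x)] is, it tends to [a x]. *)
have [c hc] := choice (fun h : R => mvt (a x) (a (h + x)) (b (h + x))).
have dq (u : R -> R) du : is_derive x 1 u du ->
    (h^-1 * (u (h + x) - u x)) @[h --> (0 : R)^'] --> du.
  move=> Du; have := @ex_derive _ _ _ _ _ _ _ Du.
  have := @derive_val _ _ _ _ _ _ _ Du; rewrite /derive /derivable => <- cu.
  by under [X in X @ _ --> _]eq_fun do rewrite -[X in u (X + _)]mulr1.
have cu (u : R -> R) du : is_derive x 1 u du -> u (h + x) @[h --> (0 : R)^'] --> u x.
  move=> Du; have cux : {for x, continuous u}.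
    by apply: differentiable_continuous; apply/derivable1_diffP; exact: ex_derive.
  have cux0 : u y @[y --> 0 + x] --> u x by rewrite add0r.
  apply: (cvg_comp (fun h => h + x)) cux0.
  apply: cvg_within_filter.
  by apply: cvgD; [exact: cvg_id|exact: cvg_cst].
have cc : c h @[h --> (0 : R)^'] --> a x.
  apply/cvgrPdist_lt => e e0.
  have := cu _ _ Da => /cvgrPdist_lt/(_ e e0); apply: filterS => h.
  rewrite distrC => ha; rewrite distrC; apply: le_lt_trans ha.
  by have [] := hc h.
have key : (h^-1 * (f (a (h + x), b (h + x)) - f (a x, b x))) @[h --> (0 : R)^'] -->
    pderiv [:: false] f (a x, b x) * da + pderiv [:: true] f (a x, b x) * db.
  rewrite (_ : (fun h : R => _) = (fun h => pderiv [:: false] f (c h, b (h + x)) *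
    (h^-1 * (a (h + x) - a x)) + h^-1 * (f (a x, b (h + x)) - f (a x, b x)))); last first.
    apply/funext => h; have [_ E] := hc h.
    rewrite mulrCA -E; ring.
  apply: cvgD; last exact: (dq _ _ ft).
  apply: cvgM; last exact: dq.
  have cp := @smooth_continuous [:: false] f sf (a x, b x).
  apply: (cvg_comp (fun h => (c h, b (h + x)))) cp.
  exact: (cvg_pair cc (cu _ _ Db)).
have key' : (h^-1 *: (((fun y => f (a y, b y)) \o shift x) (h *: (1 : R)) - f (a x, b x)))
   @[h --> (0 : R)^'] -->
    pderiv [:: false] f (a x, b x) * da + pderiv [:: true] f (a x, b x) * db.
  by under [X in X @ _ --> _]eq_fun do rewrite /= /GRing.scale/= mulr1.
split; first by apply/cvg_ex; eexists; exact: key'.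
exact: (cvg_lim _ key').
Qed.

End Partial.

(** * Green's identity on the light cone *)

Section PointwiseDerive.
Context {R : realType}.
Implicit Types (u v : R -> R) (x du dv : R).

Lemma derD u v x du dv : is_derive x 1 u du -> is_derive x 1 v dv ->
  is_derive x 1 (fun y => u y + v y) (du + dv).
Proof. by move=> Du Dv; exact: is_deriveD. Qed.

Lemma derB u v x du dv : is_derive x 1 u du -> is_derive x 1 v dv ->
  is_derive x 1 (fun y => u y - v y) (du - dv).
Proof. by move=> Du Dv; exact: is_deriveB. Qed.

Lemma derM u v x du dv : is_derive x 1 u du -> is_derive x 1 v dv ->
  is_derive x 1 (fun y => u y * v y) (du * v x + u x * dv).
Proof.
move=> Du Dv; have := is_deriveM Du Dv; congr is_derive.
by rewrite /GRing.scale/= addrC mulrC.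
Qed.

Lemma derX2 u x du : is_derive x 1 u du ->
  is_derive x 1 (fun y => u y ^+ 2) (2 * u x * du).
Proof.
move=> Du; have := derM Du Du; congr is_derive; last ring.
Qed.

Lemma derN u x du : is_derive x 1 u du -> is_derive x 1 (fun y => - u y) (- du).
Proof. by move=> Du; exact: is_deriveN. Qed.

Lemma der_cst (c x : R) : is_derive x 1 (fun=> c) 0.
Proof. exact: is_derive_cst. Qed.

Lemma der_id x : is_derive x 1 (fun y => y) 1.
Proof. exact: is_derive_id. Qed.

Lemma der_comp (f u : R -> R) x df du : is_derive (u x) 1 f df ->
  is_derive x 1 u du -> is_derive x 1 (fun y => f (u y)) (df * du).
Proof. by move=> Df Du; exact: is_derive1_comp. Qed.

Lemma der_exp u x du : is_derive x 1 u du ->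
  is_derive x 1 (fun y => expR (u y)) (expR (u x) * du).
Proof. by move=> Du; apply: der_comp. Qed.

(** Derivatives are assembled as explicit terms from the rules above; this rule then trades the raw
    value for a closed form, leaving a polynomial identity. *)
Lemma der_eq u v x du dv : is_derive x 1 u du -> u =1 v -> du = dv -> is_derive x 1 v dv.
Proof. by move=> Du /funext <- <-. Qed.

End PointwiseDerive.

Section Radial.
Context {R : realType}.
Implicit Types (M : R) (g : R -> R) (phi : R * R -> R) (z : R * R).

(** Signed half-width of the cone at time [t]: positive in the future of [t0], negative in the
    past. *)
Definition light_radius (t0 t : R) := expR (- t0) - expR (- t).

(** This is [(4 s0 s)^(-1/2)], written as an exponential so that its derivative is half of
    itself. *)
Definition radial_amplitude (t0 t : R) := 2^-1 * expR (2^-1 * (t + t0)).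

Definition radial_variable (t0 : R) z :=
  (light_radius t0 z.2 ^+ 2 - z.1 ^+ 2) * radial_amplitude t0 z.2 ^+ 2.

Definition radial (t0 : R) g z := radial_amplitude t0 z.2 * g (radial_variable t0 z).

Definition klein_gordon M phi z := pderiv [:: true; true] phi z
  - expR (- z.2) ^+ 2 * pderiv [:: false; false] phi z + M ^+ 2 * phi z.

End Radial.

Section Core.
Context {R : realType}.
Local Notation mu := (@lebesgue_measure R).
Variables (M t0 : R) (g g1 g2 : R -> R) (phi : R * R -> R).
Hypotheses (cg : continuous g) (cg1 : continuous g1) (cg2 : continuous g2).
Hypothesis Dg : forall w : R, 0 <= w -> is_derive w 1 g (g1 w).
Hypothesis Dg1 : forall w : R, 0 <= w -> is_derive w 1 g1 (g2 w).
Hypothesis ode : forall w : R, 0 <= w ->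
  w * (1 + w) * g2 w + (1 + 2 * w) * g1 w + (4^-1 + M ^+ 2) * g w = 0.
Hypothesis sphi : smooth phi.

(* The integration variables are [y] and [t], with [x = rho t * y].  [Wt], [Wx], [Ut], [Ux] and
   [Ft], [Fx] are partial derivatives in [(x, t)]; a suffix ['t] (resp. ['y]) marks the derivative
   in [t] at fixed [y] (resp. in [y] at fixed [t]). *)
Let s (t : R) := expR (- t).
Let s0 := expR (- t0).
Let rho (t : R) := s0 - s t.
Let h (t : R) := 2^-1 * expR (2^-1 * (t + t0)).
Let W (y t : R) := (rho t * h t) ^+ 2 * (1 - y ^+ 2).
(** Differentiating [(rho^2 - x^2) h^2] in [t] gives [(2 rho s + rho^2 - x^2) h^2], and
    [2 rho s + rho^2 = s0^2 - s^2]. *)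
Let Wt (y t : R) := (s0 ^+ 2 - (rho t * y) ^+ 2 - s t ^+ 2) * h t ^+ 2.
Let Wx (y t : R) := - (2 * rho t * y * h t ^+ 2).
Let on (f : R * R -> R) (y t : R) := f (rho t * y, t).
Let F := on phi.
Let Fx := on (pderiv [:: false] phi).
Let Ft := on (pderiv [:: true] phi).
Let Fxx := on (pderiv [:: false; false] phi).
Let Ftx := on (pderiv [:: false; true] phi).
Let Ftt := on (pderiv [:: true; true] phi).
Let U (y t : R) := h t * g (W y t).
Let Ut (y t : R) := h t * (2^-1 * g (W y t) + g1 (W y t) * Wt y t).
Let Ux (y t : R) := h t * (g1 (W y t) * Wx y t).
(** Green's flux in the plane is [A] in time and [- s^2 (u phi_x - u_x phi)] in space. Under
    [x = rho y] a divergence multiplied by the Jacobian [rho] is again a divergence: the time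
    component becomes [N = rho A], and since [rho' = s] the motion of the lines of constant [y] adds
    [s y A] to the spatial flux, which gives [P]. *)
Let A (y t : R) := U y t * Ft y t - Ut y t * F y t.
Let N (y t : R) := rho t * A y t.
Let P (y t : R) := s t * y * A y t + s t ^+ 2 * (U y t * Fx y t - Ux y t * F y t).

Let W't (y t : R) := (1 - y ^+ 2) * (2 * rho t * s t + rho t ^+ 2) * h t ^+ 2.
Let Wt't (y t : R) := (2 * s t ^+ 2 - 2 * rho t * s t * y ^+ 2) * h t ^+ 2 + Wt y t.
Let U't (y t : R) := 2^-1 * U y t + h t * (g1 (W y t) * W't y t).
Let Ut't (y t : R) := 2^-1 * Ut y t + h t * (2^-1 * (g1 (W y t) * W't y t)
  + (g2 (W y t) * W't y t * Wt y t + g1 (W y t) * Wt't y t)).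
Let F't (y t : R) := Fx y t * (s t * y) + Ft y t.
Let Ft't (y t : R) := Ftx y t * (s t * y) + Ftt y t.
Let A't (y t : R) := U't y t * Ft y t + U y t * Ft't y t - (Ut't y t * F y t + Ut y t * F't y t).
Let N't (y t : R) := s t * A y t + rho t * A't y t.

Let W'y (y t : R) := - (2 * y * (rho t * h t) ^+ 2).
Let U'y (y t : R) := h t * (g1 (W y t) * W'y y t).
(** The last [W'y] is the derivative of [Wt] in [y]: [Wt] and [W] differ by a term free of [y]. *)
Let Ut'y (y t : R) := h t * (2^-1 * (g1 (W y t) * W'y y t)
  + (g2 (W y t) * W'y y t * Wt y t + g1 (W y t) * W'y y t)).
Let Ux'y (y t : R) := h t * (g2 (W y t) * W'y y t * Wx y t - g1 (W y t) * (2 * rho t * h t ^+ 2)).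
Let A'y (y t : R) := U'y y t * Ft y t + U y t * (Ftx y t * rho t)
  - (Ut'y y t * F y t + Ut y t * (Fx y t * rho t)).
Let P'y (y t : R) := s t * (A y t + y * A'y y t) + s t ^+ 2 * (U'y y t * Fx y t
  + U y t * (Fxx y t * rho t) - (Ux'y y t * F y t + Ux y t * (Fx y t * rho t))).

Let h_gt0 t : 0 < h t. Proof. by rewrite mulr_gt0 ?expR_gt0. Qed.

Let hs (t : R) : s t = (4 * s0 * h t ^+ 2)^-1.
Proof.
rewrite /s /s0 /h; apply: (mulIf (lt0r_neq0 (expR_gt0 t))).
rewrite -expRD addNr expR0 exprMn -expRM_natl.
rewrite (_ : 2%:R * (2^-1 * (t + t0)) = t + t0); last by field.
rewrite expRD !expRN; field.
by rewrite !gt_eqF ?expR_gt0.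
Qed.

Let Ds (t : R) : is_derive t 1 s (- s t).
Proof. by apply: der_eq (der_exp (derN (der_id t))) _ _ => //; rewrite /s; ring. Qed.

Let Drho (t : R) : is_derive t 1 rho (s t).
Proof. by apply: der_eq (derB (der_cst s0 t) (Ds t)) _ _ => //; ring. Qed.

Let Dh (t : R) : is_derive t 1 h (2^-1 * h t).
Proof.
apply: der_eq (derM (der_cst _ t) (der_exp (derM (der_cst _ t)
  (derD (der_id t) (der_cst t0 t))))) _ _ => //; rewrite /h; ring.
Qed.

Let DW't (y t : R) : is_derive t 1 (W y) (W't y t).
Proof.
apply: der_eq (derM (derX2 (derM (Drho t) (Dh t))) (der_cst (1 - y ^+ 2) t)) _ _ => //.
by rewrite /W't; field.
Qed.

Let DWt't (y t : R) : is_derive t 1 (Wt y) (Wt't y t).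
Proof.
apply: der_eq (derM (derB (derB (der_cst (s0 ^+ 2) t) (derX2 (derM (Drho t) (der_cst y t))))
  (derX2 (Ds t))) (derX2 (Dh t))) _ _ => //.
by rewrite /Wt't /Wt; field.
Qed.

Let Don't f (y t : R) : smooth f -> is_derive t 1 (on f y)
  (on (pderiv [:: false] f) y t * (s t * y) + on (pderiv [:: true] f) y t).
Proof.
move=> sf; apply: der_eq (is_derive_comp2 sf (derM (Drho t) (der_cst y t)) (der_id t)) _ _ => //.
by rewrite /on; ring.
Qed.

Let Don'y f (y t : R) : smooth f -> is_derive y 1 (on f ^~ t)
  (on (pderiv [:: false] f) y t * rho t).
Proof.
move=> sf; apply: der_eq (is_derive_comp2 sf (derM (der_cst (rho t) y) (der_id y))
  (der_cst t y)) _ _ => //.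
by rewrite /on; ring.
Qed.

(** On the rectangle the profile is evaluated only where its derivatives and its equation are
    known. *)
Let W_ge0 y t : -1 <= y <= 1 -> 0 <= W y t.
Proof.
by move=> /andP[y1 y2]; rewrite mulr_ge0 ?sqr_ge0//; nra.
Qed.

Let DN't (y t : R) : -1 <= y <= 1 -> is_derive t 1 (N y) (N't y t).
Proof.
move=> /(@W_ge0 y t) w0.
have DU : is_derive t 1 (U y) (U't y t).
  apply: der_eq (derM (Dh t) (der_comp (Dg w0) (DW't y t))) _ _ => //.
  by rewrite /U't /U; ring.
have DUt : is_derive t 1 (Ut y) (Ut't y t).
  apply: der_eq (derM (Dh t) (derD (derM (der_cst 2^-1 t) (der_comp (Dg w0) (DW't y t)))
    (derM (der_comp (Dg1 w0) (DW't y t)) (DWt't y t)))) _ _ => //.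
  by rewrite /Ut't /Ut; ring.
apply: der_eq (derM (Drho t) (derB (derM DU (Don't y t (smooth_pderiv [:: true] sphi)))
  (derM DUt (Don't y t sphi)))) _ _ => //.
Qed.

Let DP'y (y t : R) : -1 <= y <= 1 -> is_derive y 1 (P ^~ t) (P'y y t).
Proof.
move=> /(@W_ge0 y t) w0.
have DW : is_derive y 1 (W ^~ t) (W'y y t).
  apply: der_eq (derM (der_cst ((rho t * h t) ^+ 2) y)
    (derB (der_cst 1 y) (derX2 (der_id y)))) _ _ => //.
  by rewrite /W'y; ring.
have DWt : is_derive y 1 (Wt ^~ t) (W'y y t).
  apply: der_eq (derM (derB (derB (der_cst (s0 ^+ 2) y)
    (derX2 (derM (der_cst (rho t) y) (der_id y)))) (der_cst (s t ^+ 2) y))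
    (der_cst (h t ^+ 2) y)) _ _ => //.
  by rewrite /W'y; ring.
have DWx : is_derive y 1 (Wx ^~ t) (- (2 * rho t * h t ^+ 2)).
  apply: der_eq (derN (derM (derM (der_cst (2 * rho t) y) (der_id y))
    (der_cst (h t ^+ 2) y))) _ _ => //; ring.
have DgW := @der_comp _ g (W ^~ t) y _ _ (Dg w0) DW.
have Dg1W := @der_comp _ g1 (W ^~ t) y _ _ (Dg1 w0) DW.
have DU : is_derive y 1 (U ^~ t) (U'y y t).
  apply: der_eq (derM (der_cst (h t) y) DgW) _ _ => //.
  by rewrite /U'y; ring.
have DUt : is_derive y 1 (Ut ^~ t) (Ut'y y t).
  apply: der_eq (derM (der_cst (h t) y) (derD (derM (der_cst 2^-1 y) DgW)
    (derM Dg1W DWt))) _ _ => //.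
  by rewrite /Ut'y; ring.
have DUx : is_derive y 1 (Ux ^~ t) (Ux'y y t).
  apply: der_eq (derM (der_cst (h t) y) (derM Dg1W DWx)) _ _ => //.
  by rewrite /Ux'y; ring.
have DF : is_derive y 1 (F ^~ t) (Fx y t * rho t) by exact: Don'y.
have DFx : is_derive y 1 (Fx ^~ t) (Fxx y t * rho t).
  exact: Don'y (smooth_pderiv [:: false] sphi).
have DFt : is_derive y 1 (Ft ^~ t) (Ftx y t * rho t).
  exact: Don'y (smooth_pderiv [:: true] sphi).
apply: der_eq (derD (derM (derM (der_cst (s t) y) (der_id y))
  (derB (derM DU DFt) (derM DUt DF))) (derM (der_cst (s t ^+ 2) y)
  (derB (derM DU DFx) (derM DUx DF)))) _ _ => //.
rewrite /P'y /A'y /A /=.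
move: (U y t) (Ut y t) (Ux y t) (U'y y t) (Ut'y y t) (Ux'y y t) (rho t) (s t).
move: (F y t) (Fx y t) (Ft y t) (Ftx y t) (Fxx y t) => a1 a2 a3 a4 a5.
move=> b1 b2 b3 b4 b5 b6 r q.
ring.
Qed.

Let hs1 t : 4 * s0 * s t * h t ^+ 2 = 1.
Proof.
rewrite hs; field.
by rewrite !gt_eqF ?h_gt0// expR_gt0.
Qed.

(** For [u = h g(w)] the Klein-Gordon operator gives [h] times [(w_t^2 - s^2 w_x^2) g'' + (2 w_t + 4
    s^2 h^2) g' + (1/4 + M^2) g]. The identities [quad] and [lin] turn these coefficients into those
    of the profile equation; both become polynomial identities once [1] is written as
    [4 s0 s h^2]. *)
Let divergence (y t : R) : -1 <= y <= 1 ->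
  rho t * (U y t * (Ftt y t - s t ^+ 2 * Fxx y t + M ^+ 2 * F y t)) =
  N't y t - P'y y t.
Proof.
move=> /(@W_ge0 y t) w0; have r0 : s0 = rho t + s t by rewrite /rho subrK.
have quad : Wt y t ^+ 2 - s t ^+ 2 * Wx y t ^+ 2 = W y t * (1 + W y t).
  have -> : W y t * (1 + W y t) = W y t * (4 * s0 * s t * h t ^+ 2 + W y t) by rewrite hs1.
  by rewrite /Wt /Wx /W r0; ring.
have lin : 2 * Wt y t + 4 * s t ^+ 2 * h t ^+ 2 = 1 + 2 * W y t.
  have -> : 1 + 2 * W y t = 4 * s0 * s t * h t ^+ 2 + 2 * W y t by rewrite hs1.
  by rewrite /Wt /W r0; ring.
have := ode w0; rewrite -quad -lin => ode'.
apply/esym/eqP; rewrite -subr_eq0; apply/eqP.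
(* The defect in Green's identity is [- rho phi] times the operator applied to [u], that is, this
   multiple of the profile equation. *)
transitivity (- rho t * h t * F y t * 0); last by rewrite mulr0.
rewrite -{}ode'.
have W'tE : W't y t = s t * y * Wx y t + Wt y t by rewrite /W't /Wx /Wt r0; ring.
have Wt'tE : Wt't y t = s t * y * Wx y t + 2 * s t ^+ 2 * h t ^+ 2 + Wt y t.
  by rewrite /Wt't /Wx; ring.
have W'yE : W'y y t = rho t * Wx y t by rewrite /W'y /Wx; ring.
rewrite /N't /P'y /A't /A'y /A /U't /U'y /Ut't /Ut'y /Ux'y /F't /Ft't.
rewrite W'tE Wt'tE W'yE /Ux /Ut /U.
move: (g _) (g1 _) (g2 _) (Wx y t) (Wt y t) => a a1 a2 wx wt.
move: (h t) (rho t) (s t) (F y t) (Fx y t) (Ft y t) (Ftx y t) (Ftt y t) (Fxx y t).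
move=> H r S f fx ft ftx ftt fxx.
by field.
Qed.

Let Q (t : R) := s t * h t * g 0 * (F 1 t + F (-1) t).

(** At [y = 1] and [y = -1] one has [w_t = - s w_x] and [w_t = s w_x], so the [g1 0] terms of the
    two parts of [P] cancel. What remains is [s h g(0)] times the derivative of [phi] along the edge
    minus [phi / 2], which matches [(s h)' = - s h / 2]. *)
Let DQ (t : R) : is_derive t 1 Q (P 1 t - P (-1) t).
Proof.
have DF (y : R) : is_derive t 1 (F y) (Fx y t * (s t * y) + Ft y t) by exact: Don't.
apply: der_eq (derM (derM (derM (Ds t) (Dh t)) (der_cst (g 0) t))
  (derD (DF 1) (DF (-1)))) _ _ => //.
have r0 : s0 = rho t + s t by rewrite /rho subrK.
have W1 : W 1 t = 0 by rewrite /W expr1n subrr mulr0.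
have WN1 : W (-1) t = 0 by rewrite /W sqrrN expr1n subrr mulr0.
have E1 : Wt 1 t = - s t * Wx 1 t by rewrite /Wt /Wx r0; ring.
have EN1 : Wt (-1) t = s t * Wx (-1) t by rewrite /Wt /Wx r0; ring.
rewrite /P /A /U /Ut /Ux W1 WN1 E1 EN1.
move: (h t) (s t) (F 1 t) (Fx 1 t) (Ft 1 t) (F (-1) t) (Fx (-1) t) (Ft (-1) t) (Wx _ _) (Wx _ _).
by move=> H S f fx ft f' fx' ft' w w'; field.
Qed.

(** The joint continuity facts that follow are global on the plane, as Fubini on rectangles and the
    fundamental theorem above expect; hence [g], [g1], [g2] are taken continuous on the whole line
    while their equations are restricted to [w >= 0]. *)
Let kst (r : R) : continuous (fun _ : R * R => r).
Proof. exact: cont_cst. Qed.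

Let js : continuous (fun z : R * R => s z.2).
Proof. by apply: (cont1 _ (contN cont_snd)); exact: continuous_expR. Qed.

Let jrho : continuous (fun z : R * R => rho z.2).
Proof. rewrite /rho; exact: (contB (@kst s0) js). Qed.

Let jh : continuous (fun z : R * R => h z.2).
Proof.
apply: (contM (@kst 2^-1)); apply: cont1; first exact: continuous_expR.
exact: (contM (@kst 2^-1) (contD cont_snd (@kst t0))).
Qed.

Let jon (f : R * R -> R) : continuous f -> continuous (fun z : R * R => on f z.1 z.2).
Proof. by move=> cf; rewrite /on; exact: (cont2 cf (contM jrho cont_fst) cont_snd). Qed.

Let j1y : continuous (fun z : R * R => 1 - z.1 ^+ 2).
Proof. exact: (contB (@kst 1) (contX (n := 2) cont_fst)). Qed.

Let jW : continuous (fun z : R * R => W z.1 z.2).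
Proof. rewrite /W; exact: (contM (contX (n := 2) (contM jrho jh)) j1y). Qed.

Let jWt : continuous (fun z : R * R => Wt z.1 z.2).
Proof.
rewrite /Wt; exact: (contM (contB (contB (@kst (s0 ^+ 2)) (contX (n := 2) (contM jrho cont_fst)))
  (contX (n := 2) js)) (contX (n := 2) jh)).
Qed.

Let jWx : continuous (fun z : R * R => Wx z.1 z.2).
Proof.
rewrite /Wx; exact: (contN (contM (contM (contM (@kst 2) jrho) cont_fst) (contX (n := 2) jh))).
Qed.

Let jU : continuous (fun z : R * R => U z.1 z.2).
Proof. rewrite /U; exact: (contM jh (cont1 cg jW)). Qed.

Let jUt : continuous (fun z : R * R => Ut z.1 z.2).
Proof.
rewrite /Ut; exact: (contM jh (contD (contM (@kst 2^-1) (cont1 cg jW)) (contM (cont1 cg1 jW) jWt))).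
Qed.

Let jUx : continuous (fun z : R * R => Ux z.1 z.2).
Proof. rewrite /Ux; exact: (contM jh (contM (cont1 cg1 jW) jWx)). Qed.

Let jF : continuous (fun z : R * R => F z.1 z.2).
Proof. by apply: jon; exact: (@smooth_continuous _ [::]). Qed.

Let jFx : continuous (fun z : R * R => Fx z.1 z.2).
Proof. by apply: jon; exact: smooth_continuous. Qed.

Let jFt : continuous (fun z : R * R => Ft z.1 z.2).
Proof. by apply: jon; exact: smooth_continuous. Qed.

Let jFxx : continuous (fun z : R * R => Fxx z.1 z.2).
Proof. by apply: jon; exact: smooth_continuous. Qed.

Let jFtx : continuous (fun z : R * R => Ftx z.1 z.2).
Proof. by apply: jon; exact: smooth_continuous. Qed.

Let jFtt : continuous (fun z : R * R => Ftt z.1 z.2).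
Proof. by apply: jon; exact: smooth_continuous. Qed.

Let jA : continuous (fun z : R * R => A z.1 z.2).
Proof. rewrite /A; exact: (contB (contM jU jFt) (contM jUt jF)). Qed.

Let jP : continuous (fun z : R * R => P z.1 z.2).
Proof.
rewrite /P; exact: (contD (contM (contM js cont_fst) jA)
  (contM (contX (n := 2) js) (contB (contM jU jFx) (contM jUx jF)))).
Qed.

Let jN't : continuous (fun z : R * R => N't z.1 z.2).
Proof.
have jW't : continuous (fun z : R * R => W't z.1 z.2).
  rewrite /W't; exact: (contM (contM j1y (contD (contM (contM (@kst 2) jrho) js)
    (contX (n := 2) jrho))) (contX (n := 2) jh)).
have jWt't : continuous (fun z : R * R => Wt't z.1 z.2).
  rewrite /Wt't; exact: (contD (contM (contB (contM (@kst 2) (contX (n := 2) js))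
    (contM (contM (contM (@kst 2) jrho) js) (contX (n := 2) cont_fst)))
    (contX (n := 2) jh)) jWt).
have jU't : continuous (fun z : R * R => U't z.1 z.2).
  rewrite /U't; exact: (contD (contM (@kst 2^-1) jU) (contM jh (contM (cont1 cg1 jW) jW't))).
have jUt't : continuous (fun z : R * R => Ut't z.1 z.2).
  rewrite /Ut't; exact: (contD (contM (@kst 2^-1) jUt) (contM jh (contD (contM (@kst 2^-1)
    (contM (cont1 cg1 jW) jW't)) (contD (contM (contM (cont1 cg2 jW) jW't) jWt)
    (contM (cont1 cg1 jW) jWt't))))).
have jsy := contM js cont_fst.
rewrite /N't /A't /F't /Ft't; exact: (contD (contM js jA) (contM jrho (contB
  (contD (contM jU't jFt) (contM jU (contD (contM jFtx jsy) jFtt)))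
  (contD (contM jUt't jF) (contM jUt (contD (contM jFx jsy) jFt)))))).
Qed.

Let jP'y : continuous (fun z : R * R => P'y z.1 z.2).
Proof.
have jW'y : continuous (fun z : R * R => W'y z.1 z.2).
  rewrite /W'y; exact: (contN (contM (contM (@kst 2) cont_fst) (contX (n := 2) (contM jrho jh)))).
have jg1W := contM (cont1 cg1 jW) jW'y.
have jg2W := contM (cont1 cg2 jW) jW'y.
have jU'y : continuous (fun z : R * R => U'y z.1 z.2) by rewrite /U'y; exact: (contM jh jg1W).
have jUt'y : continuous (fun z : R * R => Ut'y z.1 z.2).
  rewrite /Ut'y; exact: (contM jh (contD (contM (@kst 2^-1) jg1W) (contD (contM jg2W jWt) jg1W))).
have jUx'y : continuous (fun z : R * R => Ux'y z.1 z.2).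
  rewrite /Ux'y; exact: (contM jh (contB (contM jg2W jWx) (contM (cont1 cg1 jW)
    (contM (contM (@kst 2) jrho) (contX (n := 2) jh))))).
have jA'y : continuous (fun z : R * R => A'y z.1 z.2).
  rewrite /A'y; exact: (contB (contD (contM jU'y jFt) (contM jU (contM jFtx jrho)))
    (contD (contM jUt'y jF) (contM jUt (contM jFx jrho)))).
rewrite /P'y; exact: (contD (contM js (contD jA (contM cont_fst jA'y))) (contM (contX (n := 2) js)
  (contB (contD (contM jU'y jFx) (contM jU (contM jFxx jrho)))
    (contD (contM jUx'y jF) (contM jUx (contM jFx jrho)))))).
Qed.

Let slice_y (f : R -> R -> R) (t : R) : continuous (fun z : R * R => f z.1 z.2) ->
  continuous (f ^~ t).
Proof. by move=> jf; exact: (cont2 jf cont_id (@cont_cst _ _ t)). Qed.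

Let slice_t (f : R -> R -> R) (y : R) : continuous (fun z : R * R => f z.1 z.2) ->
  continuous (f y).
Proof. by move=> jf; exact: (cont2 jf (@cont_cst _ _ y) cont_id). Qed.

Let N11 : (-1 : R) <= 1. Proof. lra. Qed.

(** The [P] part is integrated in [y] first and then in [t], with [Q] as primitive; the [N] part is
    a derivative in [t], so the order of integration is exchanged for it. *)
Lemma core_interval (a b : R) : a <= b ->
  Rintegral mu `[a, b] (fun t => Rintegral mu `[-1, 1] (fun y =>
    rho t * (U y t * (Ftt y t - s t ^+ 2 * Fxx y t + M ^+ 2 * F y t)))) =
  Rintegral mu `[-1, 1] (fun y => N y b - N y a) - (Q b - Q a).
Proof.
move=> ab.
have cP1 : continuous (fun t => P 1 t - P (-1) t).
  by apply: contB; exact: slice_t.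
transitivity (Rintegral mu `[a, b] (fun t =>
    Rintegral mu `[-1, 1] (N't ^~ t) - (P 1 t - P (-1) t))).
  apply: eq_Rintegral => t _.
  transitivity (Rintegral mu `[-1, 1] (fun y => N't y t - P'y y t)).
    by apply: eq_Rintegral => y; rewrite inE/= in_itv/= => /divergence.
  have <- : Rintegral mu `[-1, 1] (P'y ^~ t) = P 1 t - P (-1) t.
    by apply: (@Rintegral_FTC _ (P ^~ t)) => [||y /DP'y]; [exact: N11|exact: slice_y|exact].
  by apply: RintegralB => //; exact/continuous_integrable_itv/slice_y.
have <- : Rintegral mu `[a, b] (fun t => P 1 t - P (-1) t) = Q b - Q a.
  by apply: (@Rintegral_FTC _ Q).
have -> : Rintegral mu `[-1, 1] (fun y => N y b - N y a) =
    Rintegral mu `[-1, 1] (fun y => Rintegral mu `[a, b] (N't y)).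
  apply: eq_Rintegral => y; rewrite inE/= in_itv/= => y1; apply/esym.
  apply: (@Rintegral_FTC _ (N y)) => [||t _]; [exact: ab|exact: slice_t|exact: DN't].
rewrite -(Rintegral_rect_swap _ _ _ _ jN't).
apply: RintegralB => //; last exact: continuous_integrable_itv.
apply: (@integrable_rect_slice _ a b (-1) 1 (fun z => N't z.2 z.1)).
exact: (cont2 jN't cont_snd cont_fst).
Qed.

Let integrandE (y t : R) :
  rho t * (radial t0 g (rho t * y, t) * klein_gordon M phi (rho t * y, t)) =
  rho t * (U y t * (Ftt y t - s t ^+ 2 * Fxx y t + M ^+ 2 * F y t)).
Proof.
rewrite /radial /radial_variable /klein_gordon /=; congr (_ * (_ * g _ * _)).
have -> : light_radius t0 t = rho t by [].
have -> : radial_amplitude t0 t = h t by [].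
by rewrite /W; ring.
Qed.

Let N_t0 (y : R) : N y t0 = 0.
Proof. by rewrite /N /rho /s /s0 subrr mul0r. Qed.

Let N_eq0 (y t : R) : (forall s z, z.2 = t -> pderiv s phi z = 0) -> N y t = 0.
Proof.
move=> phi0; rewrite /N /A /Ft /F /on (phi0 [:: true])//.
by have /= -> := phi0 [::] (rho t * y, t); rewrite // !mulr0 subrr mulr0.
Qed.

(** Both edges reach the apex, so [phi] is counted twice, and [2 s0 h(t0) = 1] is the normalisation
    of the delta. *)
Let Q_t0 : Q t0 = g 0 * phi (0, t0).
Proof.
rewrite /Q /F /on /rho /s0 subrr !mul0r /h (_ : 2^-1 * (t0 + t0) = t0); last by field.
have : s t0 * expR t0 = 1 by rewrite /s -expRD addNr expR0.
move: (s t0) (expR t0) (phi _) (g 0) => S e f G Se.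
by transitivity (S * e * G * f); [field|rewrite Se mul1r].
Qed.

Let Q_eq0 (t : R) : (forall s z, z.2 = t -> pderiv s phi z = 0) -> Q t = 0.
Proof.
move=> phi0; rewrite /Q /F /on.
have /= -> := phi0 [::] (rho t * 1, t); last by [].
by have /= -> := phi0 [::] (rho t * -1, t); rewrite // addr0 mulr0.
Qed.

Let Rintegral0 (f : R -> R) : (forall x, f x = 0) -> Rintegral mu `[-1, 1] f = 0.
Proof.
move=> f0; rewrite (_ : f = cst 0); last exact/funext.
by rewrite Rintegral_cst// mul0r.
Qed.

Lemma radial_fundamental_future (T : R) : t0 <= T ->
  (forall s z, z.2 = T -> pderiv s phi z = 0) ->
  Rintegral mu `[t0, T] (fun t => Rintegral mu `[-1, 1] (fun y =>
    light_radius t0 t * (radial t0 g (light_radius t0 t * y, t) *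
      klein_gordon M phi (light_radius t0 t * y, t)))) = g 0 * phi (0, t0).
Proof.
move=> tT phi0.
transitivity (Rintegral mu `[t0, T] (fun t => Rintegral mu `[-1, 1] (fun y =>
    rho t * (U y t * (Ftt y t - s t ^+ 2 * Fxx y t + M ^+ 2 * F y t))))).
  by apply: eq_Rintegral => t _; apply: eq_Rintegral => y _; exact: integrandE.
rewrite (core_interval tT) Q_t0 (Q_eq0 phi0) sub0r opprK Rintegral0 ?add0r// => y.
by rewrite N_t0 (N_eq0 _ phi0) subrr.
Qed.

(** The apex is now the upper limit in time, so [Q t0] enters with the opposite sign; the integrand
    still carries the signed Jacobian, negative here. *)
Lemma radial_fundamental_past (T : R) : T <= t0 ->
  (forall s z, z.2 = T -> pderiv s phi z = 0) ->
  Rintegral mu `[T, t0] (fun t => Rintegral mu `[-1, 1] (fun y =>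
    light_radius t0 t * (radial t0 g (light_radius t0 t * y, t) *
      klein_gordon M phi (light_radius t0 t * y, t)))) = - (g 0 * phi (0, t0)).
Proof.
move=> tT phi0.
transitivity (Rintegral mu `[T, t0] (fun t => Rintegral mu `[-1, 1] (fun y =>
    rho t * (U y t * (Ftt y t - s t ^+ 2 * Fxx y t + M ^+ 2 * F y t))))).
  by apply: eq_Rintegral => t _; apply: eq_Rintegral => y _; exact: integrandE.
rewrite (core_interval tT) Q_t0 (Q_eq0 phi0) subr0 Rintegral0 ?add0r// => y.
by rewrite N_t0 (N_eq0 _ phi0) subrr.
Qed.

End Core.

(** * Reduction of an integral over the cone to the rectangle *)

Section Cone.
Context {R : realType}.
Local Notation mu := (@lebesgue_measure R).
Local Notation mu2 := (@lebesgue_measure R \x @lebesgue_measure R)%E.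

(** The absolute values cover both cones at once: [c < 0] reverses orientation, and [c = 0], the
    apex slice, makes both sides vanish. *)
Lemma Rintegral_dilation (c : R) (k : R -> R) : continuous k ->
  Rintegral mu `[- `|c|, `|c|] k = `|c| * Rintegral mu `[-1, 1] (fun y => k (c * y)).
Proof.
move=> ck.
have Dc (x : R) : is_derive x 1 (fun y : R => c * y) c.
  by have := is_deriveZ c (is_derive_id x (1 : R)); rewrite /GRing.scale/= mulr1.
have dc : derive1 (fun y : R => c * y) = cst c.
  by apply/funext => x; rewrite derive1E; exact: derive_val.
have cc : continuous (fun y : R => c * y).
  exact: (contM (@cont_cst _ _ c) cont_id).
have dLR : derivable_oo_LRcontinuous (fun y : R => c * y) (-1) 1.
  split; [by move=> x _; exact: ex_derive|..].
  - by apply: cvg_at_right_filter; exact: cc.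
  - by apply: cvg_at_left_filter; exact: cc.
have N11 : (-1 : R) <= 1 by lra.
have ckc : continuous (fun y => k (c * y)) by exact: cont1.
have [c0|c0|->] := ltgtP c 0; last 1 first.
- by rewrite normr0 oppr0 set_itv1 Rintegral_set1 mul0r.
- have := @integration_by_substitution_decreasing _ (fun y : R => c * y) k (-1) 1 N11.
  rewrite dc mulr1 mulrN1 ltr0_norm// opprK [X in _ -> X = _]/Rintegral => ->//.
  + rewrite -RintegralZl//; last exact: continuous_integrable_itv.
    by congr fine; apply: eq_integral => x _; rewrite /= mulrC.
  + by move=> x y _ _ xy; rewrite ltr_nM2l.
  + by move=> x _; exact: cvg_cst.
  + exact: is_cvg_cst.
  + exact: is_cvg_cst.
  + exact: continuous_subspaceT.
- have := @integration_by_substitution_increasing _ (fun y : R => c * y) k (-1) 1 N11.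
  rewrite dc mulr1 mulrN1 gtr0_norm// [X in _ -> X = _]/Rintegral => ->//.
  + rewrite -RintegralZl//; last exact: continuous_integrable_itv.
    by congr fine; apply: eq_integral => x _; rewrite /= mulrC.
  + by move=> x y _ _ xy; rewrite ltr_pM2l.
  + by move=> x _; exact: cvg_cst.
  + exact: is_cvg_cst.
  + exact: is_cvg_cst.
  + exact: continuous_subspaceT.
Qed.

Lemma continuous_support_bounded (k : R * R -> R) (r : R) : continuous k ->
  (forall z, ~ square r z -> k z = 0) -> exists C, forall z, `|k z| <= C.
Proof.
move=> ck k0.
have /compact_bounded[N [_ hN]] : compact (k @` square r).
  by apply: continuous_compact; [exact: continuous_subspaceT|exact: square_compact].
exists (`|N| + 1) => z; have [sz|/k0->] := pselect (square r z); last first.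
  by rewrite normr0 addr_ge0.
by apply: (hN (`|N| + 1)); [rewrite (le_lt_trans (ler_norm _)) ?ltrDl|exists z].
Qed.

Lemma closed_cone (c : R -> R) : continuous c ->
  closed [set z : R * R | `|z.1| <= c z.2].
Proof.
move=> cc.
have cf : continuous (fun z : R * R => c z.2 - `|z.1|).
  apply: contB; first exact: (cont1 cc cont_snd).
  by apply: (cont1 _ cont_fst); exact: norm_continuous.
rewrite (_ : [set _ | _] = (fun z : R * R => c z.2 - `|z.1|) @^-1` [set x | 0 <= x]).
  by apply: (closed_comp _ (@closed_ge _ 0)) => z _; exact: cf.
by apply/seteqP; split => z /=; rewrite subr_ge0.
Qed.

Lemma integrable_cone (c : R -> R) (k : R * R -> R) (r : R) :
  continuous c -> continuous k -> (forall z, ~ square r z -> k z = 0) ->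
  mu2.-integrable setT (EFin \o (k \_ [set z : R * R | `|z.1| <= c z.2])).
Proof.
move=> cc ck k0; have [C kC] := continuous_support_bounded ck k0.
apply: (@bounded_support_integrable _ _ r C).
- apply/(measurable_restrictT _ _).1.
    by apply: closed_measurable_prod; exact: closed_cone.
  by apply: measurable_funTS; exact: continuous_measurable_prod.
- move=> z; rewrite patchE; case: ifPn => // _.
  by rewrite normr0 (le_trans _ (kC z)).
- by move=> z /k0 kz; rewrite patchE kz; case: ifPn.
Qed.

(** The sign [s] selects future or past, and [s * c t] is the true half-width, equal to [|c t|] on
    [[a, b]]. Outside [[a, b]] either the slice is empty or [k] vanishes on it. Keeping [c] signed
    inside the integral leaves the integrand in the form produced by Green's identity. *)
Lemma Rintegral_cone (s : R) (c : R -> R) (k : R * R -> R) (r a b : R) :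
  `|s| = 1 -> continuous c -> continuous k -> (forall z, ~ square r z -> k z = 0) ->
  (forall t, a <= t <= b -> 0 <= s * c t) ->
  (forall t, ~~ (a <= t <= b) -> s * c t < 0 \/ forall x, k (x, t) = 0) ->
  Rintegral mu2 setT (k \_ [set z : R * R | `|z.1| <= s * c z.2]) =
  s * Rintegral mu `[a, b] (fun t => Rintegral mu `[-1, 1] (fun y => c t * k (c t * y, t))).
Proof.
move=> s1 cc ck k0 cab cNab.
have csc : continuous (fun t => s * c t) by exact: (contM (@cont_cst _ _ s) cc).
have slice t : (fun x => (k \_ [set z : R * R | `|z.1| <= s * c z.2]) (x, t)) =
    (fun x => k (x, t)) \_ `[- (s * c t), s * c t].
  apply/funext => x; rewrite !patchE; congr (if _ then _ else _).
  by apply/idP/idP; rewrite !inE/= in_itv/= ler_norml.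
have ckt t : continuous (fun x => k (x, t)).
  exact: (cont2 ck cont_id (@cont_cst _ _ t)).
rewrite Rintegral_prod21; last 2 first.
- exact: (integrable_cone csc ck k0).
- move=> t; rewrite [X in integrable _ _ X](_ : _ =
    EFin \o ((fun x => k (x, t)) \_ `[- (s * c t), s * c t])); last first.
    by rewrite -slice.
  rewrite -restrict_EFin; apply: (integrable_mkcond _ _).1 => //.
  exact: continuous_integrable_itv.
have cj : continuous (fun z : R * R => c z.1 * k (c z.1 * z.2, z.1)).
  apply: (contM (cont1 cc cont_fst)); apply: cont2 => //; last exact: cont_fst.
  exact: (contM (cont1 cc cont_fst) cont_snd).
rewrite -RintegralZl//; last first.
  exact: (@integrable_rect_slice _ a b (-1) 1 (fun z => c z.1 * k (c z.1 * z.2, z.1))).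
rewrite [RHS]Rintegral_mkcond; apply: eq_Rintegral => t _.
rewrite slice -Rintegral_mkcond patchE; case: ifPn; rewrite ?notin_setE ?inE/= in_itv/=.
  move=> tab; have sc0 := cab t tab.
  have sce : s * c t = `|c t| by rewrite -(ger0_norm sc0) normrM s1 mul1r.
  rewrite sce Rintegral_dilation// -sce -mulrA; congr (_ * _).
  rewrite RintegralZl//; apply: continuous_integrable_itv.
  by apply: (cont1 (ckt t)); exact: (contM (@cont_cst _ _ (c t)) cont_id).
move=> /negP/cNab[sc0|kt0].
  by rewrite set_itv_ge ?Rintegral_set0// bnd_simp -ltNge; lra.
rewrite (_ : (fun x => k (x, t)) = cst 0); last exact/funext.
by rewrite Rintegral_cst// mul0r.
Qed.

End Cone.

(** * The fundamental identity as an integral over the plane *)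

Section Plane.
Context {R : realType}.
Local Notation mu := (@lebesgue_measure R).
Local Notation mu2 := (@lebesgue_measure R \x @lebesgue_measure R)%E.

Lemma pderiv_support (f : R * R -> R) (A : set (R * R)) (s : seq bool) : open A ->
  (forall z, A z -> f z = 0) -> forall z, A z -> pderiv s f z = 0.
Proof.
move=> oA f0; elim: s => //= b s IH z Az.
have v0 : (if b then et else ex : R * R) != 0.
  by case: b; rewrite /et /ex; apply/eqP => -[] /eqP; rewrite oner_eq0.
rewrite (near_eq_derive (g := cst 0))//; first exact: derive_cst.
by near=> y; apply: IH; near: y; exact: open_nbhs_nbhs.
Unshelve. all: by end_near.
Qed.

Lemma continuous_radial (t0 : R) (g : R -> R) : continuous g -> continuous (radial t0 g).
Proof.
move=> cg; have ce : continuous (fun z : R * R => expR (- z.2)).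
  by apply: (cont1 _ (contN cont_snd)); exact: continuous_expR.
have ca : continuous (fun z : R * R => radial_amplitude t0 z.2).
  apply: (contM (@cont_cst _ _ 2^-1)); apply: cont1; first exact: continuous_expR.
  exact: (contM (@cont_cst _ _ 2^-1) (contD cont_snd (@cont_cst _ _ t0))).
rewrite /radial; apply: (contM ca (cont1 cg _)).
rewrite /radial_variable /light_radius.
exact: (contM (contB (contX (n := 2) (contB (@cont_cst _ _ (expR (- t0))) ce))
  (contX (n := 2) cont_fst)) (contX (n := 2) ca)).
Qed.

Lemma continuous_klein_gordon (M : R) (phi : R * R -> R) : smooth phi ->
  continuous (klein_gordon M phi).
Proof.
move=> sphi; have ce : continuous (fun z : R * R => expR (- z.2)).
  by apply: (cont1 _ (contN cont_snd)); exact: continuous_expR.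
have c s : continuous (fun z => pderiv s phi z) by exact: smooth_continuous.
rewrite /klein_gordon.
exact: (contD (contB (c _) (contM (contX (n := 2) ce) (c _)))
  (contM (@cont_cst _ _ (M ^+ 2)) (c [::]))).
Qed.

Lemma continuous_light_radius (t0 : R) : continuous (light_radius t0).
Proof.
rewrite /light_radius; apply: (contB (@cont_cst _ _ (expR (- t0)))).
by apply: (cont1 _ (contN cont_id)); exact: continuous_expR.
Qed.

Lemma radial_fundamental (sg M t0 r : R) (g g1 g2 : R -> R) (phi : R * R -> R) :
  sg = 1 \/ sg = -1 ->
  continuous g -> continuous g1 -> continuous g2 ->
  (forall w : R, 0 <= w -> is_derive w 1 g (g1 w)) ->
  (forall w : R, 0 <= w -> is_derive w 1 g1 (g2 w)) ->
  (forall w : R, 0 <= w ->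
    w * (1 + w) * g2 w + (1 + 2 * w) * g1 w + (4^-1 + M ^+ 2) * g w = 0) ->
  smooth phi -> (forall s z, ~ square r z -> pderiv s phi z = 0) ->
  Rintegral mu2 setT ((fun z => radial t0 g z * klein_gordon M phi z)
    \_ [set z : R * R | `|z.1| <= sg * light_radius t0 z.2]) = g 0 * phi (0, t0).
Proof.
move=> sg1 cg cg1 cg2 Dg Dg1 ode sphi phi0.
(* Large enough for [- T <= t0 <= T], and strictly beyond the support, so that [phi] and all its
   derivatives vanish on the slices at times [T] and [- T]. *)
pose T := `|t0| + `|r| + 1.
have [T0 T1 rT] : [/\ t0 <= T, - T <= t0 & r < T].
  by rewrite /T; have := ler_norm t0; have := ler_norm r; have := lerNnormlW (lexx `|t0|);
    have := normr_ge0 t0; have := normr_ge0 r; split; lra.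
have phiT s z : ~ (- T < z.2 < T) -> pderiv s phi z = 0.
  move=> zT; apply: phi0 => /squareP[_]; rewrite ler_norml => /andP[h1 h2]; apply: zT.
  by rewrite (le_lt_trans h2 rT) (lt_le_trans _ h1)// ltrN2.
pose k z := radial t0 g z * klein_gordon M phi z.
have ck : continuous k.
  exact: (contM (continuous_radial cg) (continuous_klein_gordon sphi)).
have k0 z : (forall s, pderiv s phi z = 0) -> k z = 0.
  by move=> h; have /= h0 := h [::]; rewrite /k /klein_gordon !h h0 !mulr0 subrr addr0 mulr0.
have ksq z : ~ square r z -> k z = 0 by move=> h; apply: k0 => s; exact: phi0.
have rho_lt t : t < t0 -> light_radius t0 t < 0.
  by move=> tt; rewrite subr_lt0 ltr_expR ltrN2.
have rho_gt t : t0 < t -> 0 < light_radius t0 t.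
  by move=> tt; rewrite subr_gt0 ltr_expR ltrN2.
have rho0 : light_radius t0 t0 = 0 by rewrite /light_radius subrr.
have rho_le t : t <= t0 -> light_radius t0 t <= 0.
  by rewrite le_eqVlt => /predU1P[->|/rho_lt/ltW//]; rewrite rho0.
have rho_ge t : t0 <= t -> 0 <= light_radius t0 t.
  by rewrite le_eqVlt => /predU1P[<-|/rho_gt/ltW//]; rewrite rho0.
case: sg1 => ->.
- rewrite (@Rintegral_cone _ 1 (light_radius t0) k r t0 T)//.
  + rewrite mul1r; apply: (@radial_fundamental_future _ M t0 g g1 g2 phi cg cg1 cg2) => //.
    by move=> s z zT; apply: phiT; rewrite zT ltxx andbF.
  + exact: normr1.
  + exact: continuous_light_radius.
  + by move=> t /andP[/rho_ge]; rewrite mul1r.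
  + move=> t; rewrite negb_and -!ltNge => /orP[/rho_lt|tT]; rewrite ?mul1r; first by left.
    by right => x; apply: k0 => s; apply: phiT => /=; lra.
- rewrite (@Rintegral_cone _ (-1) (light_radius t0) k r (- T) t0)//.
  + rewrite mulN1r; apply/eqP; rewrite eqr_oppLR; apply/eqP.
    apply: (@radial_fundamental_past _ M t0 g g1 g2 phi cg cg1 cg2) => //.
    by move=> s z zT; apply: phiT; rewrite zT ltxx.
  + by rewrite normrN normr1.
  + exact: continuous_light_radius.
  + by move=> t /andP[_ /rho_le]; rewrite mulN1r oppr_ge0.
  + move=> t; rewrite negb_and -!ltNge => /orP[tT|/rho_gt]; rewrite ?mulN1r ?oppr_lt0.
      by right => x; apply: k0 => s; apply: phiT => /=; lra.
    by left.
Qed.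

End Plane.

(** * Power series and the hypergeometric equation *)

Section PowerSeries.
Context {R : realType}.
Implicit Types (c d : nat -> R) (x : R).

(** Radius of convergence at least 1, in Abel's form. Unlike boundedness of the coefficients, it
    survives term-by-term differentiation. *)
Definition radius_ge1 c := forall K : R, 0 < K < 1 -> exists B, forall n, `|c n| * K ^+ n <= B.

Lemma bounded_radius_ge1 c B : (forall n, `|c n| <= B) -> radius_ge1 c.
Proof.
move=> cB K /andP[K0 K1]; exists B => n; apply: le_trans (cB n).
by rewrite ler_piMr// exprn_ile1// ltW.
Qed.

Lemma is_cvg_pseries_lt1 c x : radius_ge1 c -> `|x| < 1 -> cvgn (pseries c x).
Proof.
move=> rc x1; have [K /andP[xK K1]] : exists K, `|x| < K < 1.
  by exists ((`|x| + 1) / 2); lra.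
have K0 : 0 < K by rewrite (le_lt_trans _ xK).
have [|B cB] := rc K; first by rewrite K0.
apply: normed_cvg.
have q1 : `|(`|x| / K)| < 1.
  by rewrite normrM normr_id normfV (gtr0_norm K0) ltr_pdivrMr// mul1r.
apply: series_le_cvg (is_cvg_geometric_series (a := B) q1) => n //=.
  have B0 : 0 <= B by apply: le_trans (cB 0); rewrite expr0 mulr1.
  by rewrite /geometric/= mulr_ge0// exprn_ge0// divr_ge0// ltW.
rewrite normrM normrX expr_div_n mulrA ler_pdivlMr ?exprn_gt0// mulrAC.
by rewrite ler_wpM2r ?exprn_ge0.
Qed.

(** Passing from [K] to a larger [L < 1] gains a factor [(L / K)^n], which absorbs the linear factor
    [n + 1] by Bernoulli's inequality. *)
Lemma radius_ge1_diffs c : radius_ge1 c -> radius_ge1 (pseries_diffs c).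
Proof.
move=> rc K /andP[K0 K1].
have [L /andP[KL L1]] : exists L, K < L < 1 by exists ((K + 1) / 2); lra.
have L0 : 0 < L by exact: lt_trans KL.
have [|B cB] := rc L; first by rewrite L0.
pose h := L / K - 1.
have h0 : 0 < h by rewrite subr_gt0 ltr_pdivlMr// mul1r.
have bern n : n%:R * h + 1 <= (L / K) ^+ n.
  elim: n => [|n IH]; first by rewrite mul0r add0r expr0.
  have LK : L / K = 1 + h by rewrite /h addrC subrK.
  rewrite exprS {1}LK mulrDl mul1r -natr1 mulrDl mul1r addrAC lerD//.
  rewrite ler_peMr ?(ltW h0)// (le_trans _ IH)// lerDr mulr_ge0// ltW//.
(* The first factor comes from [n + 1 <= (1 + 1/h) (1 + n h)]; the division by [L] pays for the
   shifted index of the coefficient. *)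
exists ((1 + h^-1) * (B / L)) => n; rewrite /pseries_diffs normrM normr_nat.
have B0 : 0 <= B by apply: le_trans (cB 0); rewrite expr0 mulr1.
have {}cB : `|c n.+1| * L ^+ n <= B / L.
  by rewrite ler_pdivlMr// -mulrA -exprSr.
have nh : n.+1%:R <= (1 + h^-1) * (L / K) ^+ n.
  apply: le_trans (ler_wpM2l _ (bern n)); last by rewrite addr_ge0// invr_ge0 ltW.
  have -> : (1 + h^-1) * (n%:R * h + 1) = n%:R * h + 1 + n%:R + h^-1.
    by field; rewrite gt_eqF.
  rewrite -natr1; have : 0 <= n%:R * h by rewrite mulr_ge0// ltW.
  have : 0 < h^-1 by rewrite invr_gt0.
  by lra.
have KE : K ^+ n = (L / K) ^- n * L ^+ n.
  by rewrite expr_div_n invf_div divfK// gt_eqF// exprn_gt0.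
have q0 : 0 < (L / K) ^+ n by rewrite exprn_gt0// divr_gt0.
rewrite KE mulrACA; apply: ler_pM => //.
- by rewrite mulr_ge0// invr_ge0 ltW.
- by rewrite mulr_ge0// exprn_ge0// ltW.
- by rewrite ler_pdivrMr.
Qed.

Lemma radius_ge1_mulrn c : radius_ge1 c -> radius_ge1 (fun n => n%:R * c n).
Proof.
move=> rc K K01; have [B cB] := radius_ge1_diffs rc K01.
exists B => -[|n].
  rewrite mul0r normr0 mul0r (le_trans _ (cB 0))// mulr_ge0 ?exprn_ge0//.
  by case/andP: K01 => /ltW.
apply: le_trans (cB n); rewrite /pseries_diffs exprS mulrCA ler_piMl//.
  by rewrite mulr_ge0 ?exprn_ge0//; case/andP: K01 => /ltW.
by case/andP: K01 => _ /ltW.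
Qed.

Definition psum c x : R := limn (pseries c x).

Lemma is_derive_psum c x : radius_ge1 c -> `|x| < 1 ->
  is_derive x 1 (psum c) (psum (pseries_diffs c) x).
Proof.
move=> rc x1; have [K /andP[xK K1]] : exists K, `|x| < K < 1.
  by exists ((`|x| + 1) / 2); lra.
have K0 : 0 < K by rewrite (le_lt_trans _ xK).
have K1' : `|K| < 1 by rewrite gtr0_norm.
apply: (@pseries_snd_diffs _ c K x); last by rewrite (gtr0_norm K0).
- exact: is_cvg_pseries_lt1.
- by apply: is_cvg_pseries_lt1 => //; exact: radius_ge1_diffs.
- by apply: is_cvg_pseries_lt1 => //; do 2 apply: radius_ge1_diffs.
Qed.

Lemma psumD c d x : radius_ge1 c -> radius_ge1 d -> `|x| < 1 ->
  psum (fun n => c n + d n) x = psum c x + psum d x.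
Proof.
move=> rc rd x1; rewrite /psum -limD; try exact: is_cvg_pseries_lt1.
congr (limn _); apply/funext => n; rewrite /pseries /series/=.
by under eq_bigr do rewrite mulrDl; exact: big_split.
Qed.

Lemma psumZ (a : R) c x : radius_ge1 c -> `|x| < 1 ->
  psum (fun n => a * c n) x = a * psum c x.
Proof.
move=> rc x1; rewrite /psum; apply/cvg_lim => //.
rewrite (_ : pseries _ x = fun n => a * pseries c x n).
  by apply: cvgM; [exact: cvg_cst|exact: is_cvg_pseries_lt1].
apply/funext => n; rewrite /pseries /series/=.
by under eq_bigr do rewrite -mulrA; rewrite -mulr_sumr.
Qed.

Lemma radius_ge1D c d : radius_ge1 c -> radius_ge1 d -> radius_ge1 (fun n => c n + d n).
Proof.
move=> rc rd K K01; have [[B cB] [C dC]] := (rc K K01, rd K K01).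
exists (B + C) => n; apply: le_trans (lerD (cB n) (dC n)); rewrite -mulrDl.
by rewrite ler_wpM2r ?ler_normD// exprn_ge0//; case/andP: K01 => /ltW.
Qed.

Lemma radius_ge1Z (a : R) c : radius_ge1 c -> radius_ge1 (fun n => a * c n).
Proof.
move=> rc K K01; have [B cB] := rc K K01.
by exists (`|a| * B) => n; rewrite normrM -mulrA ler_wpM2l.
Qed.

(** The Euler operator [x d/dx] multiplies the n-th coefficient by [n]; the constant term dies, so
    the two series agree after a shift by one. *)
Lemma mul_psum_diffs c x : radius_ge1 c -> `|x| < 1 ->
  x * psum (pseries_diffs c) x = psum (fun n => n%:R * c n) x.
Proof.
move=> rc x1; have cn := is_cvg_pseries_lt1 (radius_ge1_mulrn rc) x1.
rewrite /psum; apply/esym/cvg_lim => //; rewrite -cvg_shiftS.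
rewrite (_ : (fun n => _) = fun n => x * pseries (pseries_diffs c) x n).
  apply: cvgM; first exact: cvg_cst.
  by apply: is_cvg_pseries_lt1 => //; exact: radius_ge1_diffs.
apply/funext => n; rewrite /pseries /series/= big_nat_recl// mul0r mul0r add0r.
rewrite mulr_sumr; apply: eq_bigr => i _; rewrite /pseries_diffs exprS; ring.
Qed.

End PowerSeries.

Local Open Scope complex_scope.
Local Notation Re := complex.Re.
Local Notation Im := complex.Im.

(** * The Gauss series with [a = b = 1/2 + iM] and its Pfaff transform *)

Section HypergeometricSeries.
Context {R : realType}.
Variable M : R.

Let a : R[i] := 2^-1 + (0 +i* M).
Let c (n : nat) : R[i] := poch a n * poch a n / (poch 1 n * n`!%:R).
Let cr (n : nat) : R := Re (c n).
Let ci (n : nat) : R := Im (c n).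
(** [qr n] and [qi n] are the real and imaginary parts of the coefficient ratio
    [((n + a) / (n + 1))^2]. *)
Let qr (n : nat) : R := ((n%:R + 2^-1) ^+ 2 - M ^+ 2) / (n.+1%:R : R) ^+ 2.
Let qi (n : nat) : R := 2 * M * (n%:R + 2^-1) / (n.+1%:R : R) ^+ 2.

Let natC (n : nat) : (n%:R : R[i]) = (n%:R : R)%:C.
Proof. by rewrite rmorph_nat. Qed.

Let aE (n : nat) : a + n%:R = (2^-1 + n%:R) +i* M.
Proof.
rewrite /a natC (_ : (2^-1 : R[i]) = (2^-1)%:C); first by simpc.
by rewrite fmorphV natC.
Qed.

Let cS (n : nat) : c n.+1 = c n * (qr n +i* qi n).
Proof.
have n1 : (n%:R + 1 : R) != 0 by rewrite natr1 pnatr_eq0.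
have qE : (a + n%:R) ^+ 2 = n.+1%:R ^+ 2 * (qr n +i* qi n).
  rewrite aE natC -rmorphXn/= expr2; simpc.
  congr (_ +i* _); rewrite /qr /qi -natr1; field; rewrite addrC; exact: n1.
transitivity (c n * ((a + n%:R) ^+ 2 / n.+1%:R ^+ 2)); last first.
  by congr (_ * _); rewrite qE mulrC mulKf// expf_neq0// pnatr_eq0.
rewrite /c /poch !big_ord_recr/= -natr1 factS natrM [1 + _]addrC natr1.
have f0 : (n`!%:R : R[i]) != 0 by rewrite pnatr_eq0 -lt0n fact_gt0.
have p0 : \prod_(i < n) (1 + i%:R : R[i]) != 0.
  by apply/prodf_neq0 => i _; rewrite addrC natr1 pnatr_eq0.
field.
by rewrite p0 f0 addrC natr1 pnatr_eq0.
Qed.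

Let crS (n : nat) : cr n.+1 = cr n * qr n - ci n * qi n.
Proof. by rewrite /cr cS /cr /ci; case: (c n). Qed.

Let ciS (n : nat) : ci n.+1 = cr n * qi n + ci n * qr n.
Proof. by rewrite /ci cS /cr /ci; case: (c n). Qed.

Let bounded_decr (u : nat -> R) (N : nat) :
  (forall n, (N <= n)%N -> u n.+1 <= u n) -> exists B, forall n, u n <= B.
Proof.
move=> uN; exists (\sum_(i < N.+1) `|u i|) => n.
have le_small k : (k <= N)%N -> u k <= \sum_(i < N.+1) `|u i|.
  move=> kN; rewrite (bigD1 (Ordinal (kN : (k < N.+1)%N)))//=.
  by rewrite (le_trans (ler_norm _))// lerDl sumr_ge0.
elim: n => [|n IH]; first exact: le_small.
have [nN|Nn] := ltnP n N; first exact: le_small.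
exact: le_trans (uN _ Nn) IH.
Qed.

(** The ratio of consecutive coefficients has modulus [((n + 1/2)^2 + M^2) / (n + 1)^2], which is at
    most 1 once [n >= M^2], because [(n + 1)^2 - (n + 1/2)^2 = n + 3/4]. The squared modulus is thus
    eventually nonincreasing, hence bounded. *)
Let radius_c : radius_ge1 cr /\ radius_ge1 ci.
Proof.
have [N MN] : exists N : nat, M ^+ 2 <= N%:R.
  exists (Num.truncn (M ^+ 2)).+1; exact/ltW/truncnS_gt.
have [B cB] : exists B, forall n, cr n ^+ 2 + ci n ^+ 2 <= B.
  apply: (@bounded_decr _ N) => n Nn.
  have -> : cr n.+1 ^+ 2 + ci n.+1 ^+ 2 =
      (cr n ^+ 2 + ci n ^+ 2) * (qr n ^+ 2 + qi n ^+ 2).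
    by rewrite crS ciS; ring.
  rewrite ler_piMr ?addr_ge0 ?sqr_ge0//.
  have n1 : 0 < (n.+1%:R : R) by rewrite ltr0n.
  have -> : qr n ^+ 2 + qi n ^+ 2 =
      (((n%:R + 2^-1) ^+ 2 + M ^+ 2) / (n.+1%:R : R) ^+ 2) ^+ 2.
    by rewrite /qr /qi; move: n1; move: (n.+1%:R) => m m0; field; rewrite gt_eqF.
  rewrite exprn_ile1//; first by rewrite divr_ge0 ?addr_ge0 ?sqr_ge0.
  rewrite ler_pdivrMr ?exprn_gt0// mul1r -[in leRHS]natr1.
  have : (N%:R : R) <= n%:R by rewrite ler_nat.
  have -> : (n%:R + 1 : R) ^+ 2 = (n%:R + 2^-1) ^+ 2 + (n%:R + 3 / 4) by field.
  by rewrite lerD2l => h; apply: le_trans MN _; apply: le_trans h _; rewrite lerDl; lra.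
have norm_le (x : R) : `|x| <= 1 + x ^+ 2.
  rewrite -(real_normK (num_real x)); move: `|x| => y.
  rewrite -subr_ge0 (_ : _ - y = (y - 2^-1) ^+ 2 + 3 / 4); last by field.
  by rewrite addr_ge0 ?sqr_ge0// divr_ge0.
split; apply: (@bounded_radius_ge1 _ _ (1 + B)) => n;
  rewrite (le_trans (norm_le _))// lerD2l (le_trans _ (cB n))//.
- by rewrite lerDl sqr_ge0.
- by rewrite lerDr sqr_ge0.
Qed.

Lemma normc_le (x y : R) : `|x +i* y| <= (`|x| + `|y|)%:C.
Proof.
rewrite normc_def/= lecR.
have -> : `|x| + `|y| = Num.sqrt ((`|x| + `|y|) ^+ 2).
  by rewrite sqrtr_sqr; apply/esym/ger0_norm; exact: addr_ge0.
rewrite ler_wsqrtr// [in leRHS]sqrrD.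
by rewrite !real_normK ?num_real// addrAC lerDl mulrn_wge0// mulr_ge0.
Qed.

Lemma cvg_complex (u v : nat -> R) (x y : R) : u @ \oo --> x -> v @ \oo --> y ->
  (fun n => (u n +i* v n : R[i]^o)) @ \oo --> (x +i* y : R[i]^o).
Proof.
move=> ux vy; apply/cvgrPdist_lt => e e0.
(* Positivity in [R[i]] forces a zero imaginary part, so the tolerance is a real number. *)
have eE : e = (Re e)%:C by move: e0; rewrite ltcE => /andP[/eqP + _]; case: e => er ei /= ->.
have e1 : 0 < Re e / 2 by rewrite divr_gt0//; move: e0; rewrite eE ltcR.
near=> n; rewrite eE.
have -> : (x +i* y) - (u n +i* v n) = (x - u n) +i* (y - v n) by simpc.
apply: le_lt_trans (normc_le _ _) _; rewrite ltcR.
rewrite (splitr (Re e)) ltrD//.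
  by near: n; move/cvgrPdist_lt : ux; exact.
by near: n; move/cvgrPdist_lt : vy; exact.
Unshelve. all: by end_near.
Qed.

Lemma hyp2F1_psum (x : R) : `|x| < 1 -> hyp2F1 a a 1 x%:C = psum cr x +i* psum ci x.
Proof.
move=> x1; have [rr ri] := radius_c.
have L := cvg_complex (is_cvg_pseries_lt1 rr x1) (is_cvg_pseries_lt1 ri x1).
apply: etrans (cvg_lim (@norm_hausdorff _ R[i]^o) L); rewrite /hyp2F1.
congr (lim (_ @ \oo)).
apply/funext => n; rewrite /pseries /series/=.
elim: n => [|n IH]; first by rewrite !big_geq.
rewrite !big_nat_recr//= IH -/(c n) -rmorphXn /cr /ci; case: (c n) => p q /=.
by simpc.
Qed.

Let rr := radius_c.1.
Let ri := radius_c.2.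

(** With [theta = x d/dx] and [f] the sum of the series, the three left-hand sides are [theta f],
    [(d/dx) theta f] and [theta^2 f]. *)
Let psum_euler (d : nat -> R) (x : R) : radius_ge1 d -> `|x| < 1 ->
  let S1 := psum (pseries_diffs d) x in
  let S2 := psum (pseries_diffs (pseries_diffs d)) x in
  [/\ x * S1 = psum (fun n => n%:R * d n) x,
      S1 + x * S2 = psum (fun n => n.+1%:R * (n.+1%:R * d n.+1)) x &
      x * (S1 + x * S2) = psum (fun n => n%:R * (n%:R * d n)) x].
Proof.
move=> rd x1 /=.
have E : psum (pseries_diffs d) x + x * psum (pseries_diffs (pseries_diffs d)) x =
    psum (pseries_diffs (fun n => n%:R * d n)) x.
  rewrite mul_psum_diffs//; last exact: radius_ge1_diffs.
  rewrite -psumD//; [|exact: radius_ge1_diffs|exact/radius_ge1_mulrn/radius_ge1_diffs].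
  congr psum; apply/funext => n; rewrite /pseries_diffs.
  by rewrite -{3 4}natr1; ring.
split; [exact: mul_psum_diffs|exact: E|rewrite E].
by rewrite mul_psum_diffs//; exact: radius_ge1_mulrn.
Qed.

(** The pattern is one component of [(theta + a)^2 = theta^2 + 2 a theta + a^2], where
    [2 a = 1 + 2iM] and [a^2 = 1/4 - M^2 + iM]; [u] and [v] carry the cross terms between real and
    imaginary parts. *)
Let comb (d e : nat -> R) (u v : R) (x : R) : radius_ge1 d -> radius_ge1 e -> `|x| < 1 ->
  psum (fun n => n%:R * (n%:R * d n) + (n%:R * d n + (u * (n%:R * e n) +
    ((4^-1 - M ^+ 2) * d n + v * e n)))) x =
  psum (fun n => n%:R * (n%:R * d n)) x + (psum (fun n => n%:R * d n) x +
    (u * psum (fun n => n%:R * e n) x + ((4^-1 - M ^+ 2) * psum d x + v * psum e x))).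
Proof.
move=> rd re x1.
have rnd := radius_ge1_mulrn rd; have rne := radius_ge1_mulrn re.
have r1 := radius_ge1D (radius_ge1Z (4^-1 - M ^+ 2) rd) (radius_ge1Z v re).
have r2 := radius_ge1D (radius_ge1Z u rne) r1.
have r3 := radius_ge1D rnd r2.
rewrite (psumD (radius_ge1_mulrn rnd) r3 x1) (psumD rnd r2 x1).
rewrite (psumD (radius_ge1Z u rne) r1 x1).
rewrite (psumD (radius_ge1Z (4^-1 - M ^+ 2) rd) (radius_ge1Z v re) x1).
by rewrite !psumZ.
Qed.

(** This is the hypergeometric equation [(d/dx) theta F = (theta + a)^2 F] in components; on
    coefficients it reads [(n + 1)^2 c_{n+1} = (n + a)^2 c_n]. *)
Let psum_ode (x : R) : `|x| < 1 ->
  let X := psum cr x in let Y := psum ci x in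
  let X1 := psum (pseries_diffs cr) x in let Y1 := psum (pseries_diffs ci) x in
  let X2 := psum (pseries_diffs (pseries_diffs cr)) x in
  let Y2 := psum (pseries_diffs (pseries_diffs ci)) x in
  X1 + x * X2 = x * (X1 + x * X2) + (x * X1 + (- (2 * M) * (x * Y1) +
    ((4^-1 - M ^+ 2) * X + - M * Y))) /\
  Y1 + x * Y2 = x * (Y1 + x * Y2) + (x * Y1 + (2 * M * (x * X1) +
    ((4^-1 - M ^+ 2) * Y + M * X))).
Proof.
move=> x1 /=.
have [r1 r2 r3] := psum_euler rr x1; have [i1 i2 i3] := psum_euler ri x1.
have n0 n : (n%:R + 1 : R) != 0 by rewrite natr1 pnatr_eq0.
split.
- rewrite r3 r1 i1 -comb// r2; congr psum; apply/funext => n.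
  by rewrite crS /qr /qi -[n.+1%:R]natr1; field; rewrite addrC.
- rewrite i3 r1 i1 -comb// i2; congr psum; apply/funext => n.
  by rewrite ciS /qr /qi -[n.+1%:R]natr1; field; rewrite addrC.
Qed.

Let psum0 (d : nat -> R) : psum d 0 = d 0%N.
Proof.
rewrite /psum; apply/cvg_lim => //; rewrite -cvg_shiftS.
rewrite (_ : (fun n => _) = cst (d 0%N)); first exact: cvg_cst.
apply/funext => n; rewrite /pseries /series/= big_nat_recl// expr0 mulr1.
by rewrite big1 ?addr0// => i _; rewrite exprS mul0r mulr0.
Qed.

(* Real and imaginary parts of [(1 + w) ^ (- a)]. *)
Let Hr (w : R) := expR (- 2^-1 * ln (1 + w)) * cos (M * ln (1 + w)).
Let Hi (w : R) := - (expR (- 2^-1 * ln (1 + w)) * sin (M * ln (1 + w))).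
Let q (w : R) := (1 + w)^-1.

Let Dq (w : R) : - 2^-1 < w -> is_derive w 1 q (- q w ^+ 2).
Proof.
move=> w0; have w1 : 1 + w != 0 by rewrite gt_eqF//; lra.
have D := @is_deriveV _ (fun y => 1 + y) w _ 1 w1 (derD (der_cst 1 w) (der_id w)).
by apply: der_eq D _ _ => //; rewrite /q /GRing.scale/=; field.
Qed.

Let Dln (w : R) : - 2^-1 < w -> is_derive w 1 (fun w => ln (1 + w)) (q w).
Proof.
move=> w0; have w1 : 0 < 1 + w by lra.
apply: der_eq (der_comp (is_derive1_ln w1) (derD (der_cst 1 w) (der_id w))) _ _ => //.
by rewrite add0r mulr1.
Qed.

Let DHr (w : R) : - 2^-1 < w -> is_derive w 1 Hr (q w * (- 2^-1 * Hr w + M * Hi w)).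
Proof.
move=> w0; have Dl := Dln w0.
apply: der_eq (derM (der_exp (derM (der_cst (- 2^-1) w) Dl))
  (@der_comp _ cos (fun w => M * ln (1 + w)) w _ _ (is_derive_cos _)
    (derM (der_cst M w) Dl))) _ _ => //.
by rewrite /Hr /Hi; ring.
Qed.

Let DHi (w : R) : - 2^-1 < w -> is_derive w 1 Hi (q w * (- 2^-1 * Hi w - M * Hr w)).
Proof.
move=> w0; have Dl := Dln w0.
apply: der_eq (derN (derM (der_exp (derM (der_cst (- 2^-1) w) Dl))
  (@der_comp _ sin (fun w => M * ln (1 + w)) w _ _ (is_derive_sin _)
    (derM (der_cst M w) Dl)))) _ _ => //.
by rewrite /Hr /Hi; ring.
Qed.

(** The bound [- 1/2] is where [w / (1 + w)] reaches [-1], the edge of the disc of convergence. *)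
Let z_lt1 (w : R) : - 2^-1 < w -> `|w * q w| < 1.
Proof.
move=> w0; have w1 : 0 < 1 + w by lra.
rewrite /q normrM normfV (gtr0_norm w1) ltr_pdivrMr// mul1r ltr_norml.
by apply/andP; split; lra.
Qed.

Let Dz (w : R) : - 2^-1 < w -> is_derive w 1 (fun w => w * q w) (q w ^+ 2).
Proof.
move=> w0; apply: der_eq (derM (der_id w) (Dq w0)) _ _ => //.
by rewrite /q; field; rewrite gt_eqF//; lra.
Qed.

(** [Pr] and [Pi] are the real and imaginary parts of [(1 + w)^(-a)] times the series with
    coefficients [d + i e] at [w / (1 + w)]. This class is stable under differentiation: the
    prefactor contributes [- a q], and the argument of the series [q^2]. *)
Let Pr (d e : nat -> R) (w : R) := Hr w * psum d (w * q w) - Hi w * psum e (w * q w).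
Let Pi (d e : nat -> R) (w : R) := Hr w * psum e (w * q w) + Hi w * psum d (w * q w).

Let DPr (d e : nat -> R) (w : R) : radius_ge1 d -> radius_ge1 e -> - 2^-1 < w ->
  is_derive w 1 (Pr d e) (q w * (- 2^-1 * Pr d e w + M * Pi d e w)
    + q w ^+ 2 * Pr (pseries_diffs d) (pseries_diffs e) w).
Proof.
move=> rd re w0.
have Dd := @der_comp _ (psum d) (fun w => w * q w) w _ _ (is_derive_psum rd (z_lt1 w0)) (Dz w0).
have De := @der_comp _ (psum e) (fun w => w * q w) w _ _ (is_derive_psum re (z_lt1 w0)) (Dz w0).
apply: der_eq (derB (derM (DHr w0) Dd) (derM (DHi w0) De)) _ _ => //.
by rewrite /Pr /Pi; ring.
Qed.

Let DPi (d e : nat -> R) (w : R) : radius_ge1 d -> radius_ge1 e -> - 2^-1 < w ->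
  is_derive w 1 (Pi d e) (q w * (- 2^-1 * Pi d e w - M * Pr d e w)
    + q w ^+ 2 * Pi (pseries_diffs d) (pseries_diffs e) w).
Proof.
move=> rd re w0.
have Dd := @der_comp _ (psum d) (fun w => w * q w) w _ _ (is_derive_psum rd (z_lt1 w0)) (Dz w0).
have De := @der_comp _ (psum e) (fun w => w * q w) w _ _ (is_derive_psum re (z_lt1 w0)) (Dz w0).
apply: der_eq (derD (derM (DHr w0) De) (derM (DHi w0) Dd)) _ _ => //.
by rewrite /Pr /Pi; ring.
Qed.

Let dcr := pseries_diffs cr.
Let dci := pseries_diffs ci.
(** [G + i Gi] is the profile; [K + i Ki] and [L + i Li] are the same prefactor times the first and
    second derivatives of the hypergeometric function. *)
Let G := Pr cr ci.
Let Gi := Pi cr ci.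
Let K := Pr dcr dci.
Let Ki := Pi dcr dci.
Let L := Pr (pseries_diffs dcr) (pseries_diffs dci).
Let Li := Pi (pseries_diffs dcr) (pseries_diffs dci).
Let G1 (w : R) := q w * (- 2^-1 * G w + M * Gi w) + q w ^+ 2 * K w.
Let Gi1 (w : R) := q w * (- 2^-1 * Gi w - M * G w) + q w ^+ 2 * Ki w.
Let K1 (w : R) := q w * (- 2^-1 * K w + M * Ki w) + q w ^+ 2 * L w.
Let Ki1 (w : R) := q w * (- 2^-1 * Ki w - M * K w) + q w ^+ 2 * Li w.
Let G2 (w : R) := - q w ^+ 2 * (- 2^-1 * G w + M * Gi w) +
  q w * (- 2^-1 * G1 w + M * Gi1 w) + (2 * q w * - q w ^+ 2 * K w + q w ^+ 2 * K1 w).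
Let Gi2 (w : R) := - q w ^+ 2 * (- 2^-1 * Gi w - M * G w) +
  q w * (- 2^-1 * Gi1 w - M * G1 w) + (2 * q w * - q w ^+ 2 * Ki w + q w ^+ 2 * Ki1 w).

Let DG (w : R) : - 2^-1 < w -> is_derive w 1 G (G1 w).
Proof. exact: DPr. Qed.

Let DGi (w : R) : - 2^-1 < w -> is_derive w 1 Gi (Gi1 w).
Proof. exact: DPi. Qed.

Let DK (w : R) : - 2^-1 < w -> is_derive w 1 K (K1 w).
Proof. by apply: DPr; exact: radius_ge1_diffs. Qed.

Let DKi (w : R) : - 2^-1 < w -> is_derive w 1 Ki (Ki1 w).
Proof. by apply: DPi; exact: radius_ge1_diffs. Qed.

Let DG1 (w : R) : - 2^-1 < w -> is_derive w 1 G1 (G2 w).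
Proof.
move=> w0; apply: der_eq (derD (derM (Dq w0) (derD (derM (der_cst (- 2^-1) w) (DG w0))
  (derM (der_cst M w) (DGi w0)))) (derM (derX2 (Dq w0)) (DK w0))) _ _ => //.
by rewrite !mul0r !add0r.
Qed.

Let DGi1 (w : R) : - 2^-1 < w -> is_derive w 1 Gi1 (Gi2 w).
Proof.
move=> w0; apply: der_eq (derD (derM (Dq w0) (derB (derM (der_cst (- 2^-1) w) (DGi w0))
  (derM (der_cst M w) (DG w0)))) (derM (derX2 (Dq w0)) (DKi w0))) _ _ => //.
by rewrite !mul0r !add0r.
Qed.

(** A third derivative is a cheap way to get continuity of the second; its value is left
    implicit. *)
Let derivable_G2 (w : R) : - 2^-1 < w -> exists d d', is_derive w 1 G2 d /\ is_derive w 1 Gi2 d'.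
Proof.
move=> w0; have c2 := der_cst (- 2^-1) w; have cM := der_cst M w; have c22 := der_cst 2 w.
have Dq0 := Dq w0; have DqN := derN (derX2 Dq0).
have DK1 : exists d, is_derive w 1 K1 d.
  have DL := DPr (radius_ge1_diffs (radius_ge1_diffs rr))
    (radius_ge1_diffs (radius_ge1_diffs ri)) w0.
  eexists; exact: (derD (derM Dq0 (derD (derM c2 (DK w0)) (derM cM (DKi w0))))
    (derM (derX2 Dq0) DL)).
have DKi1 : exists d, is_derive w 1 Ki1 d.
  have DL := DPi (radius_ge1_diffs (radius_ge1_diffs rr))
    (radius_ge1_diffs (radius_ge1_diffs ri)) w0.
  eexists; exact: (derD (derM Dq0 (derB (derM c2 (DKi w0)) (derM cM (DK w0))))
    (derM (derX2 Dq0) DL)).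
have [[d Dd] [d' Dd']] := (DK1, DKi1); do 2 eexists; split.
- exact: (derD (derD (derM DqN (derD (derM c2 (DG w0)) (derM cM (DGi w0))))
    (derM Dq0 (derD (derM c2 (DG1 w0)) (derM cM (DGi1 w0)))))
    (derD (derM (derM (derM c22 Dq0) DqN) (DK w0)) (derM (derX2 Dq0) Dd))).
- exact: (derD (derD (derM DqN (derB (derM c2 (DGi w0)) (derM cM (DG w0))))
    (derM Dq0 (derB (derM c2 (DGi1 w0)) (derM cM (DG1 w0)))))
    (derD (derM (derM (derM c22 Dq0) DqN) (DKi w0)) (derM (derX2 Dq0) Dd'))).
Qed.

(** The equation is complex linear, so it persists after multiplying by [h + ik], which will be the
    prefactor [(1 + w)^(-a)]. *)
Let twist (x y x1 y1 x2 y2 z h k : R) :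
  x1 + z * x2 = z * (x1 + z * x2) + (z * x1 + (- (2 * M) * (z * y1) +
    ((4^-1 - M ^+ 2) * x + - M * y))) ->
  y1 + z * y2 = z * (y1 + z * y2) + (z * y1 + (2 * M * (z * x1) +
    ((4^-1 - M ^+ 2) * y + M * x))) ->
  let u := h * x - k * y in let v := h * y + k * x in
  let u1 := h * x1 - k * y1 in let v1 := h * y1 + k * x1 in
  let u2 := h * x2 - k * y2 in let v2 := h * y2 + k * x2 in
  u1 + z * u2 = z * (u1 + z * u2) + (z * u1 - 2 * M * (z * v1) +
    ((4^-1 - M ^+ 2) * u - M * v)) /\
  v1 + z * v2 = z * (v1 + z * v2) + (z * v1 + 2 * M * (z * u1) +
    ((4^-1 - M ^+ 2) * v + M * u)).
Proof.
move=> e1 e2 /=; have [h1 h2] := (congr1 ( *%R h) e1, congr1 ( *%R h) e2).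
have [k1 k2] := (congr1 ( *%R k) e1, congr1 ( *%R k) e2).
by split; lra.
Qed.

(** Up to the factor [q w], the left-hand side is the defect of the hypergeometric equation at
    [w / (1 + w)], already multiplied by the prefactor. *)
Let G_ode (w : R) : - 2^-1 < w ->
  w * (1 + w) * G2 w + (1 + 2 * w) * G1 w + (4^-1 + M ^+ 2) * G w = 0 /\
  w * (1 + w) * Gi2 w + (1 + 2 * w) * Gi1 w + (4^-1 + M ^+ 2) * Gi w = 0.
Proof.
move=> w0; have [e1 e2] := psum_ode (z_lt1 w0).
have qE : 1 + w = (q w)^-1 by rewrite /q invrK.
have q0 : q w != 0 by rewrite invr_eq0 gt_eqF//; lra.
(* Eliminating [w] in favour of [q w] makes the comparison an identity of rational functions. *)
have wE : w = (1 - q w) / q w by rewrite mulrBl mul1r divff// -qE addrC addKr.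
have [er ei] := twist (Hr w) (Hi w) e1 e2.
move/eqP: er; rewrite -subr_eq0 => /eqP er; move/eqP: ei; rewrite -subr_eq0 => /eqP ei.
rewrite -/(Pr cr ci w) -/(Pi cr ci w) -/G -/Gi in er ei.
rewrite -/(Pr dcr dci w) -/(Pi dcr dci w) -/K -/Ki in er ei.
rewrite -/(Pr (pseries_diffs dcr) (pseries_diffs dci) w) -/L in er.
rewrite -/(Pi (pseries_diffs dcr) (pseries_diffs dci) w) -/Li in ei.
split.
- rewrite -[RHS](mulr0 (q w)) -{}er /G2 /K1 /G1 /Gi1.
  move: (G w) (Gi w) (K w) (Ki w) (L w) (q w) q0 wE => g gi k ki l Q Q0 ->.
  by field.
- rewrite -[RHS](mulr0 (q w)) -{}ei /Gi2 /Ki1 /G1 /Gi1.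
  move: (G w) (Gi w) (K w) (Ki w) (Li w) (q w) q0 wE => g gi k ki l Q Q0 ->.
  by field.
Qed.

(* [clamp w = max (w, - 1/4)]: precomposing with it turns a function that is
   smooth near [0, +oo[ into a globally continuous one with the same derivatives there. *)
Let clamp (w : R) := 2^-1 * (w - 4^-1 + `|w + 4^-1|).

Let clamp_id (w : R) : - 4^-1 <= w -> clamp w = w.
Proof. by move=> w0; rewrite /clamp ger0_norm; [field|lra]. Qed.

Let clamp_gt (w : R) : - 2^-1 < clamp w.
Proof.
have := normr_ge0 (w + 4^-1); have := lerNnormlW (lexx `|w + 4^-1|).
by rewrite /clamp; lra.
Qed.

Let continuous_clamp : continuous clamp.
Proof.
apply: (contM (@cont_cst _ _ 2^-1)); apply: (contD (contB cont_id (@cont_cst _ _ 4^-1))).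
by apply: (cont1 _ (contD cont_id (@cont_cst _ _ 4^-1))); exact: norm_continuous.
Qed.

Let clamp_continuous (f : R -> R) :
  (forall w : R, - 2^-1 < w -> exists d, is_derive w 1 f d) -> continuous (f \o clamp).
Proof.
move=> Df w; apply: (continuous_comp (@continuous_clamp w)).
have [d Dfw] := Df _ (clamp_gt w).
by apply: differentiable_continuous; apply/derivable1_diffP; exact: ex_derive.
Qed.

Let clamp_derive (f : R -> R) (d w : R) : 0 <= w -> is_derive w 1 f d ->
  is_derive w 1 (f \o clamp) d.
Proof.
move=> w0; apply: near_eq_is_derive; near=> v; rewrite /= clamp_id// ltW//.
by near: v; apply: lt_nbhsr; lra.
Unshelve. all: by end_near.
Qed.

Let gt0_clamp (w : R) : 0 <= w -> - 2^-1 < w /\ clamp w = w.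
Proof. by move=> w0; split; [|apply: clamp_id]; lra. Qed.

Definition riemann_profile (g : R -> R) := exists g1 g2 : R -> R,
  [/\ continuous g, continuous g1 & continuous g2] /\
  [/\ forall w : R, 0 <= w -> is_derive w 1 g (g1 w),
      forall w : R, 0 <= w -> is_derive w 1 g1 (g2 w) &
      forall w : R, 0 <= w ->
        w * (1 + w) * g2 w + (1 + 2 * w) * g1 w + (4^-1 + M ^+ 2) * g w = 0].

Let c0 : c 0 = 1.
Proof. by rewrite /c /poch !big_ord0 fact0 !mul1r invr1. Qed.

(** In the kernel [A = 4 s0 s], and [A (1 + w)] is the denominator. The phase of [A^(iM)] cancels
    that of [A^(-a)], leaving the real factor [A^(-1/2)]. *)
Lemma riemann_profile_hyp2F1 : exists g gi : R -> R,
  [/\ riemann_profile g, riemann_profile gi, g 0 = 1, gi 0 = 0 &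
  forall A w : R, 0 < A -> 0 <= w ->
    cpow A (0 +i* M) * cpow (A * (1 + w)) (- a) * hyp2F1 a a 1 (w / (1 + w))%:C =
    (expR (- 2^-1 * ln A))%:C * (g w +i* gi w)].
Proof.
have m00 : clamp 0 = 0 by apply: clamp_id; lra.
have H0 : Hr 0 = 1 /\ Hi 0 = 0.
  by rewrite /Hr /Hi addr0 ln1 !mulr0 expR0 cos0 sin0 mulr0 oppr0 mulr1.
have [Hr0 Hi0] := H0.
exists (G \o clamp), (Gi \o clamp); split.
- exists (G1 \o clamp), (G2 \o clamp); split; split.
  + by apply: clamp_continuous => w /DG; exists (G1 w).
  + by apply: clamp_continuous => w /DG1; exists (G2 w).
  + by apply: clamp_continuous => w /derivable_G2[d [_ [? _]]]; exists d.
  + by move=> w w0; have [w1 E] := gt0_clamp w0; rewrite /= E; apply: clamp_derive (DG w1).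
  + by move=> w w0; have [w1 E] := gt0_clamp w0; rewrite /= E; apply: clamp_derive (DG1 w1).
  + by move=> w w0; have [w1 E] := gt0_clamp w0; rewrite /= E; have [] := G_ode w1.
- exists (Gi1 \o clamp), (Gi2 \o clamp); split; split.
  + by apply: clamp_continuous => w /DGi; exists (Gi1 w).
  + by apply: clamp_continuous => w /DGi1; exists (Gi2 w).
  + by apply: clamp_continuous => w /derivable_G2[_ [d [_ ?]]]; exists d.
  + by move=> w w0; have [w1 E] := gt0_clamp w0; rewrite /= E; apply: clamp_derive (DGi w1).
  + by move=> w w0; have [w1 E] := gt0_clamp w0; rewrite /= E; apply: clamp_derive (DGi1 w1).
  + by move=> w w0; have [w1 E] := gt0_clamp w0; rewrite /= E; have [] := G_ode w1.
- by rewrite /= m00 /G /Pr Hr0 Hi0 !mul0r psum0 /cr c0 subr0 mulr1.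
- by rewrite /= m00 /Gi /Pi Hr0 Hi0 !mul0r psum0 /ci c0 /= mulr0 addr0.
move=> A w A0 w0; have [w1 E] := gt0_clamp w0.
have u0 : 0 < 1 + w by lra.
rewrite hyp2F1_psum /=; last exact: z_lt1.
rewrite E /G /Gi /Pr /Pi -/(q w); move: (psum ci _) (psum cr _) => Y X.
rewrite /cpow /cexp lnM ?posrE//.
have -> : - a = (- 2^-1) +i* (- M).
  rewrite /a (_ : (2^-1 : R[i]) = (2^-1)%:C); first by simpc.
  by rewrite fmorphV natC.
rewrite /Hr /Hi; move: (ln A) (ln (1 + w)) => l k; simpc.
rewrite /= expR0 !mul1r cosN sinN.
have -> : - (2^-1 * (l + k)) = - (2^-1 * l) + - (2^-1 * k) by ring.
rewrite expRD !mulrDr cosD sinD; have := cos2Dsin2 (M * l).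
move: (cos (M * l)) (sin (M * l)) (cos (M * k)) (sin (M * k)) => cl sl ck sk.
move: (expR _) (expR _) => e1 e2 cs.
congr (_ +i* _).
(* The cancelling phases appear as [cos^2 + sin^2] of [M ln A]. *)
- transitivity ((cl ^+ 2 + sl ^+ 2) * (e1 * (e2 * ck * X + e2 * sk * Y))); first ring.
  by rewrite cs; ring.
- transitivity ((cl ^+ 2 + sl ^+ 2) * (e1 * (e2 * ck * Y - e2 * sk * X))); first ring.
  by rewrite cs; ring.
Qed.

End HypergeometricSeries.

(** * Distributions *)

Section ConeDistribution.
Context {R : realType}.
Local Notation mu2 := (@lebesgue_measure R \x @lebesgue_measure R)%E.
Implicit Types (phi psi : R * R -> R) (g : R -> R).

Lemma derive_ex_mull (G : R -> R) phi (z : R * R) : derivable phi z ex ->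
  'D_ex (fun z => G z.2 * phi z) z = G z.2 * 'D_ex phi z.
Proof.
move=> dphi; apply/cvg_lim => //.
rewrite (_ : (fun h : R => _) =
  (fun h : R => G z.2 * (h^-1 *: ((phi \o shift z) (h *: (ex : R * R)) - phi z)))).
  by apply: cvgM; [exact: cvg_cst|exact: dphi].
apply/funext => h /=; have -> : h * 0 + z.2 = z.2 by rewrite mulr0 add0r.
by rewrite /GRing.scale/= -mulrBr mulrCA.
Qed.

(** [t, x, p] stand for pairings of the real profile with the real part of the test function,
    [u, y, q] for those of the imaginary profile; primes mark the imaginary part of the test
    function. *)
Lemma complex_combination (m t x p t' x' p' u y q u' y' q' P Q : R) :
  t - x + m * p = P -> t' - x' + m * p' = Q -> u - y + m * q = 0 -> u' - y' + m * q' = 0 ->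
  ((t - u') +i* (t' + u)) - ((x - y') +i* (x' + y)) + m%:C * ((p - q') +i* (p' + q)) =
  P +i* Q :> R[i].
Proof.
move=> <- <- h h'; simpc; congr (_ +i* _).
  by transitivity (t - x + m * p - (u' - y' + m * q')); [ring|rewrite h' subr0].
by transitivity (t' - x' + m * p' + (u - y + m * q)); [ring|rewrite h addr0].
Qed.

Lemma KGE (M : R) (T : functional) (phi : R * R -> R[i]) : KG M T phi =
  T (cderive et (cderive et phi)) -
  T (cderive ex (cderive ex (fun z => (expR (- 2 * z.2))%:C * phi z))) +
  (M ^+ 2)%:C * T phi.
Proof.
congr (_ + _); congr (_ + _); first exact: opprK (T (cderive et (cderive et phi))).
congr (- _); exact: opprK (T (cderive ex (cderive ex (fun z => _ * phi z)))).
Qed.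

(** Continuity is all that the pairings require, so derivatives of test functions multiplied by
    [e^{-2t}] are covered directly; the explicit [r] lets one square serve all derivatives. *)
Definition compactly_supported (r : R) phi :=
  continuous phi /\ forall z, ~ square r z -> phi z = 0.

Lemma test_function_supported (phi : R * R -> R[i]) : test_function phi ->
  exists r, forall s, compactly_supported r (pderiv s (fun z => Re (phi z))) /\
    compactly_supported r (pderiv s (fun z => Im (phi z))).
Proof.
move=> [sr si cK]; have [r r0 Kr] := compact_subset_square cK.
have oK : open (~` closure [set z | phi z != 0]) by exact/closed_openC/closed_closure.
have phi0 z : (~` closure [set z | phi z != 0]) z -> phi z = 0.
  by move=> /= h; apply/eqP/negP => /negP /(@subset_closure _ [set z | phi z != 0] z) /h.
exists r => s; split; (split; first exact: smooth_continuous) => z zr.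
- by apply: (pderiv_support s oK) => [{}z /phi0 ->//|]; apply: contra_not zr; exact: Kr.
- by apply: (pderiv_support s oK) => [{}z /phi0 ->//|]; apply: contra_not zr; exact: Kr.
Qed.

Variables (sg M t0 : R).
Hypothesis sg1 : sg = 1 \/ sg = -1.

Let D : set (R * R) := [set z | `|z.1| <= sg * light_radius t0 z.2].

Definition cone_pairing g phi := Rintegral mu2 setT (fun z => (radial t0 g \_ D) z * phi z).

Let pairingE g phi : (fun z => (radial t0 g \_ D) z * phi z) =
  (fun z => radial t0 g z * phi z) \_ D.
Proof. by apply/funext => z; rewrite !patchE; case: ifPn => // _; rewrite mul0r. Qed.

Let continuous_sg : continuous (fun t => sg * light_radius t0 t).
Proof. exact: (contM (@cont_cst _ _ sg) (@continuous_light_radius _ t0)). Qed.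

Let pairing_integrable g phi r : continuous g -> compactly_supported r phi ->
  mu2.-integrable setT (EFin \o (fun z => (radial t0 g \_ D) z * phi z)).
Proof.
move=> cg [cphi phi0]; rewrite pairingE.
apply: (@integrable_cone _ (fun t => sg * light_radius t0 t) _ r continuous_sg).
  exact: (contM (continuous_radial cg) cphi).
by move=> z /phi0 ->; rewrite mulr0.
Qed.

Lemma compactly_supportedD r phi psi : compactly_supported r phi ->
  compactly_supported r psi -> compactly_supported r (fun z => phi z + psi z).
Proof.
move=> [c1 s1] [c2 s2]; split; first exact: (contD c1 c2).
by move=> z zr; rewrite s1// s2// addr0.
Qed.

Lemma compactly_supportedM r (h phi : R * R -> R) : continuous h ->
  compactly_supported r phi -> compactly_supported r (fun z => h z * phi z).
Proof.
move=> ch [c1 s1]; split; first exact: (contM ch c1).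
by move=> z zr; rewrite s1// mulr0.
Qed.

Lemma compactly_supportedZ r (c : R) phi :
  compactly_supported r phi -> compactly_supported r (fun z => c * phi z).
Proof. by apply: compactly_supportedM; exact: cont_cst. Qed.

Lemma compactly_supported_le r r' phi : r <= r' ->
  compactly_supported r phi -> compactly_supported r' phi.
Proof.
move=> rr' [c s]; split=> // z zr; apply: s; apply: contra_not zr => /squareP[h1 h2].
by apply/squareP; split; exact: le_trans rr'.
Qed.

Let pairingD g phi psi r : continuous g -> compactly_supported r phi ->
  compactly_supported r psi ->
  cone_pairing g (fun z => phi z + psi z) = cone_pairing g phi + cone_pairing g psi.
Proof.
move=> cg sphi spsi; rewrite /cone_pairing -RintegralD//; last 2 first.
- exact: pairing_integrable sphi.
- exact: pairing_integrable spsi.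
by apply: eq_Rintegral => z _; rewrite mulrDr.
Qed.

Let pairingZ g (c : R) phi r : continuous g -> compactly_supported r phi ->
  cone_pairing g (fun z => c * phi z) = c * cone_pairing g phi.
Proof.
move=> cg sphi; rewrite /cone_pairing -RintegralZl//; last exact: pairing_integrable sphi.
by apply: eq_Rintegral => z _; rewrite mulrCA.
Qed.

Let radial_bounded g (K : set (R * R)) : continuous g -> compact K ->
  exists2 S, 0 <= S & forall z, K z -> `|(radial t0 g \_ D) z| <= S.
Proof.
move=> cg cK.
have /compact_bounded[N [_ hN]] : compact (radial t0 g @` K).
  by apply: continuous_compact => //; apply: continuous_subspaceT; exact: continuous_radial.
exists (`|N| + 1); first by rewrite addr_ge0.
move=> z Kz; rewrite patchE; case: ifPn => _; last by rewrite normr0 addr_ge0.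
by apply: (hN (`|N| + 1)); [rewrite (le_lt_trans (ler_norm _)) ?ltrDl|exists z].
Qed.

Let measurable_radial g : continuous g -> measurable_fun setT (radial t0 g \_ D).
Proof.
move=> cg; apply/(measurable_restrictT _ _).1.
  by apply: closed_measurable_prod; exact: (closed_cone continuous_sg).
by apply: measurable_funTS; apply: continuous_measurable_prod; exact: continuous_radial.
Qed.

Let radial_loc_integrable g (K : set (R * R)) : continuous g -> compact K ->
  mu2.-integrable K (EFin \o (radial t0 g \_ D)).
Proof.
move=> cg cK; have [r r0 Kr] := compact_subset_square cK.
have mK := compact_measurable_prod cK.
have [S S0 hS] := radial_bounded cg cK.
apply: measurable_bounded_integrable => //.
- apply: le_lt_trans (square_mu_lty r); apply: le_measure => //; rewrite inE//.
  exact: square_measurable.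
- by apply: measurable_funTS; exact: measurable_radial.
- exists S; split; first exact: num_real.
  by move=> x Sx z Kz /=; exact: le_trans (hS z Kz) (ltW Sx).
Qed.

(** The kernel is bounded on compact sets, so the distribution has order zero. *)
Let pairing_bound g (r : R) : continuous g -> exists2 C, 0 <= C &
  forall phi B, compactly_supported r phi -> 0 <= B -> (forall z, `|phi z| <= B) ->
    `|cone_pairing g phi| <= C * B.
Proof.
move=> cg; have [S S0 hS] := radial_bounded cg (@square_compact _ r).
have msq := @square_measurable _ r.
exists (S * fine (mu2 (square r))); first by rewrite mulr_ge0// fine_ge0.
move=> phi B sphi B0 hB; rewrite /cone_pairing.
have phi0 := sphi.2.
have -> : (fun z => (radial t0 g \_ D) z * phi z) =
    (fun z => (radial t0 g \_ D) z * phi z) \_ (square r).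
  apply/funext => z; rewrite [RHS]patchE; case: ifPn => //; rewrite notin_setE => /phi0 ->.
  by rewrite mulr0.
rewrite -Rintegral_mkcond.
have int1 : mu2.-integrable (square r) (EFin \o (fun z => (radial t0 g \_ D) z * phi z)).
  by apply: integrableS (pairing_integrable cg sphi).
apply: le_trans (le_normr_Rintegral _ int1) _ => //.
apply: (@le_trans _ _ (Rintegral mu2 (square r) (cst (S * B)))).
  apply: le_Rintegral => //.
  - exact: integrable_norm.
  - apply: measurable_bounded_integrable => //; first exact: square_mu_lty.
    exists `|S * B|; split; first exact: num_real.
    by move=> x /ltW Sx z _.
  - by move=> z zr; rewrite normrM ler_pM// hS.
by rewrite Rintegral_cst// mulrAC.
Qed.

Let pairing_klein_gordon g phi r : riemann_profile M g -> smooth phi ->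
  (forall s, compactly_supported r (pderiv s phi)) ->
  cone_pairing g (pderiv [:: true; true] phi)
  - cone_pairing g (fun z => expR (- 2 * z.2) * pderiv [:: false; false] phi z)
  + M ^+ 2 * cone_pairing g phi = g 0 * phi (0, t0).
Proof.
move=> [g1 [g2 [[cg cg1 cg2] [Dg Dg1 ode]]]] sphi supp.
have <- := @radial_fundamental _ sg M t0 r g g1 g2 phi sg1 cg cg1 cg2 Dg Dg1 ode sphi
  (fun s => (supp s).2).
rewrite -pairingE -/D -/(cone_pairing g (klein_gordon M phi)).
have ce : continuous (fun z : R * R => expR (- 2 * z.2)).
  apply: (cont1 _ (contM (@cont_cst _ _ (- 2)) cont_snd)); exact: continuous_expR.
have s1 := supp [:: true; true].
have s2 := compactly_supportedM ce (supp [:: false; false]).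
have s3 := compactly_supportedZ (M ^+ 2) (supp [::]).
(* The difference is written with [-1] as a coefficient so that additivity and homogeneity of the
   pairing suffice. *)
have -> : klein_gordon M phi = (fun z => (pderiv [:: true; true] phi z +
    -1 * (expR (- 2 * z.2) * pderiv [:: false; false] phi z)) + M ^+ 2 * pderiv [::] phi z).
  apply/funext => z; rewrite /klein_gordon mulN1r.
  by rewrite -expRM_natl mulrN -mulNr.
rewrite (pairingD cg (compactly_supportedD s1 (compactly_supportedZ (-1) s2)) s3).
rewrite (pairingD cg s1 (compactly_supportedZ (-1) s2)).
by rewrite (pairingZ _ cg s2) (pairingZ _ cg (supp [::])) mulN1r.
Qed.

Variables (g gi : R -> R) (f : R * R -> R[i]).
Hypotheses (pg : riemann_profile M g) (pgi : riemann_profile M gi).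
Hypotheses (g0 : g 0 = 1) (gi0 : gi 0 = 0).
Hypothesis fE : forall z, f z = (radial t0 g \_ D) z +i* (radial t0 gi \_ D) z.

Let cg : continuous g. Proof. by case: pg => ? [? [[]]]. Qed.
Let cgi : continuous gi. Proof. by case: pgi => ? [? [[]]]. Qed.

Lemma cone_loc_integrable : loc_integrable f.
Proof.
move=> K cK; split.
- rewrite (_ : (fun z => _) = EFin \o (radial t0 g \_ D)).
    exact: radial_loc_integrable.
  by apply/funext => z /=; rewrite fE.
- rewrite (_ : (fun z => _) = EFin \o (radial t0 gi \_ D)).
    exact: radial_loc_integrable.
  by apply/funext => z /=; rewrite fE.
Qed.

Let distE (phi : R * R -> R[i]) r :
  compactly_supported r (fun z => Re (phi z)) ->
  compactly_supported r (fun z => Im (phi z)) ->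
  dist_of_fun f phi =
  (cone_pairing g (fun z => Re (phi z)) - cone_pairing gi (fun z => Im (phi z))) +i*
  (cone_pairing g (fun z => Im (phi z)) + cone_pairing gi (fun z => Re (phi z))).
Proof.
move=> sr si; rewrite /dist_of_fun /cintegral; congr (_ +i* _).
- rewrite /cone_pairing -RintegralB//; [|exact: pairing_integrable sr|exact: pairing_integrable si].
  by apply: eq_Rintegral => z _; rewrite fE; case: (phi z).
- rewrite /cone_pairing -RintegralD//; [|exact: pairing_integrable si|exact: pairing_integrable sr].
  by apply: eq_Rintegral => z _; rewrite fE; case: (phi z).
Qed.

Let cone_distribution : distribution (dist_of_fun f).
Proof.
split.
- move=> phi psi /test_function_supported[r1 h1] /test_function_supported[r2 h2].
  have [[r1r r1i] [r2r r2i]] := (h1 [::], h2 [::]); pose r := Num.max r1 r2.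
  have l1 : r1 <= r by rewrite le_max lexx.
  have l2 : r2 <= r by rewrite le_max lexx orbT.
  have pr := compactly_supported_le l1 r1r; have pi := compactly_supported_le l1 r1i.
  have qr := compactly_supported_le l2 r2r; have qi := compactly_supported_le l2 r2i.
  have Er : (fun z => Re (phi z + psi z)) = (fun z => Re (phi z) + Re (psi z)).
    by apply/funext => z; case: (phi z) (psi z) => ? ? [].
  have Ei : (fun z => Im (phi z + psi z)) = (fun z => Im (phi z) + Im (psi z)).
    by apply/funext => z; case: (phi z) (psi z) => ? ? [].
  rewrite (distE pr pi) (distE qr qi) (@distE _ r) ?Er ?Ei; [|exact: compactly_supportedD..].
  rewrite (pairingD cg pr qr) (pairingD cgi pi qi) (pairingD cg pi qi) (pairingD cgi pr qr).
  by simpc; congr (_ +i* _); ring.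
- move=> [c d] phi /test_function_supported[r /(_ [::])[pr pi]].
  have Er : (fun z => Re ((c +i* d) * phi z)) = (fun z => c * Re (phi z) + - d * Im (phi z)).
    by apply/funext => z; case: (phi z) => ? ? /=; rewrite mulNr.
  have Ei : (fun z => Im ((c +i* d) * phi z)) = (fun z => c * Im (phi z) + d * Re (phi z)).
    by apply/funext => z; case: (phi z).
  have zr := compactly_supportedZ; rewrite (distE pr pi) (@distE _ r) ?Er ?Ei; last 2 first.
  + by apply: compactly_supportedD; exact: zr.
  + by apply: compactly_supportedD; exact: zr.
  rewrite (pairingD cg (zr _ c _ pr) (zr _ (- d) _ pi)) (pairingD cgi (zr _ c _ pi) (zr _ d _ pr)).
  rewrite (pairingD cg (zr _ c _ pi) (zr _ d _ pr)) (pairingD cgi (zr _ c _ pr) (zr _ (- d) _ pi)).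
  rewrite !(pairingZ _ cg pr) !(pairingZ _ cg pi) !(pairingZ _ cgi pr) !(pairingZ _ cgi pi).
  by simpc; congr (_ +i* _); ring.
- move=> K cK; have [r r0 Kr] := compact_subset_square cK.
  have [C C0 hC] := pairing_bound r cg; have [C' C'0 hC'] := pairing_bound r cgi.
  (* The real and imaginary parts are each at most [(C + C') * B], and their sum bounds the
     modulus. *)
  exists 0%N, (2 * (C + C')) => phi B tphi phiK hB.
  have B0 : 0 <= B by have [] := hB [::] (0, 0) isT; move=> + _; exact: le_trans.
  have hr z : `|Re (phi z)| <= B by have [] := hB [::] z isT.
  have hi z : `|Im (phi z)| <= B by have [] := hB [::] z isT.
  have phi0 z : ~ square r z -> phi z = 0.
    by move=> zr; apply: phiK; apply: contra_not zr; exact: Kr.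
  have [sr si _] := tphi.
  have pr : compactly_supported r (fun z => Re (phi z)).
    by split=> [|z /phi0 ->//]; exact: (@smooth_continuous _ [::]).
  have pi : compactly_supported r (fun z => Im (phi z)).
    by split=> [|z /phi0 ->//]; exact: (@smooth_continuous _ [::]).
  rewrite (distE pr pi); apply: le_trans (normc_le _ _) _; rewrite lecR.
  have := ler_normB (cone_pairing g (fun z => Re (phi z))) (cone_pairing gi (fun z => Im (phi z))).
  have := ler_normD (cone_pairing g (fun z => Im (phi z))) (cone_pairing gi (fun z => Re (phi z))).
  have := hC _ _ pr B0 hr; have := hC _ _ pi B0 hi.
  have := hC' _ _ pr B0 hr; have := hC' _ _ pi B0 hi.
  by rewrite mulrDr mulrDl -!mulrA; lra.
Qed.

Lemma cone_fundamental_solution : fundamental_solution M (0, t0) (dist_of_fun f).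
Proof.
split; first exact: cone_distribution.
move=> phi tphi; have [r supp] := test_function_supported tphi.
have [sr si _] := tphi.
pose pr := fun z => Re (phi z); pose pi := fun z => Im (phi z).
pose e := fun z : R * R => expR (- 2 * z.2).
have ce : continuous e.
  apply: (cont1 _ (contM (@cont_cst _ _ (- 2)) cont_snd)); exact: continuous_expR.
have dxx (u : R * R -> R) : smooth u ->
    'D_ex ('D_ex (fun z => e z * u z)) = (fun z => e z * pderiv [:: false; false] u z).
  move=> su; have -> : 'D_ex (fun z => e z * u z) = (fun z => e z * pderiv [:: false] u z).
    apply/funext => z; apply: (@derive_ex_mull (fun t => expR (- 2 * t))).
    by case: (su [::] z) => _ h _; exact: h.
  apply/funext => z; apply: (@derive_ex_mull (fun t => expR (- 2 * t))).
  by case: (su [:: false] z) => _ h _; exact: h.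
have Exx : cderive ex (cderive ex (fun z => (e z)%:C * phi z)) =
    (fun z => (e z * pderiv [:: false; false] pr z) +i* (e z * pderiv [:: false; false] pi z)).
  rewrite /cderive /=; apply/funext => z; congr (_ +i* _).
  - rewrite (_ : (fun y => Re (_ * phi y)) = (fun y => e y * pr y)).
      by have /(congr1 (@^~ z)) := dxx _ sr.
    by apply/funext => y; rewrite /pr; case: (phi y) => p q /=; rewrite mul0r subr0.
  - rewrite (_ : (fun y => Im (_ * phi y)) = (fun y => e y * pi y)).
      by have /(congr1 (@^~ z)) := dxx _ si.
    by apply/funext => y; rewrite /pi; case: (phi y) => p q /=; rewrite mul0r addr0.
have Ett : cderive et (cderive et phi) =
  (fun z => pderiv [:: true; true] pr z +i* pderiv [:: true; true] pi z) by [].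
rewrite KGE -/e Exx Ett.
have s1 := supp [:: true; true]; have s2 := supp [:: false; false].
have s3 := supp [::].
rewrite (@distE (fun z => _ +i* _) r s1.1 s1.2) (@distE phi r s3.1 s3.2).
rewrite (@distE (fun z => _ +i* _) r
  (compactly_supportedM ce s2.1) (compactly_supportedM ce s2.2)).
have k1 := etrans (pairing_klein_gordon pg sr (fun s => (supp s).1))
  (etrans (congr1 ( *%R^~ _) g0) (mul1r _)).
have k2 := etrans (pairing_klein_gordon pg si (fun s => (supp s).2))
  (etrans (congr1 ( *%R^~ _) g0) (mul1r _)).
have k3 := etrans (pairing_klein_gordon pgi sr (fun s => (supp s).1))
  (etrans (congr1 ( *%R^~ _) gi0) (mul0r _)).
have k4 := etrans (pairing_klein_gordon pgi si (fun s => (supp s).2))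
  (etrans (congr1 ( *%R^~ _) gi0) (mul0r _)).
apply: etrans (complex_combination k1 k2 k3 k4) _.
by rewrite /delta; case: (phi _).
Qed.

End ConeDistribution.

(** * Identification of the kernel with the radial solution *)

Section HypergeometricKernel.
Context {R : realType}.

(** With [A = 4 s0 s], numerator and denominator are [A w] and [A (1 + w)], and [A^(-1/2)] is the
    amplitude. The condition on [z] describes both cones together and amounts to [w >= 0]. *)
Lemma E_radial (M t0 : R) (g gi : R -> R) :
  (forall A w : R, 0 < A -> 0 <= w ->
    cpow A (0 +i* M) * cpow (A * (1 + w)) (- (2^-1 + (0 +i* M)))
      * hyp2F1 (2^-1 + (0 +i* M)) (2^-1 + (0 +i* M)) 1 (w / (1 + w))%:C =
    (expR (- 2^-1 * ln A))%:C * (g w +i* gi w)) ->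
  forall z : R * R, `|z.1| <= `|light_radius t0 z.2| ->
  E M z 0 t0 = radial t0 g z +i* radial t0 gi z.
Proof.
move=> hE [x t] /= xr; rewrite /E /= subr0.
pose A := 4 * expR (- t0 - t); pose w := radial_variable t0 (x, t).
have A0 : 0 < A by rewrite mulr_gt0 ?expR_gt0.
have w0 : 0 <= w.
  rewrite mulr_ge0 ?sqr_ge0//= subr_ge0 -(real_normK (num_real x)).
  rewrite -(real_normK (num_real (light_radius t0 t))).
  by rewrite lerXn2r// nnegrE.
have AE : A = 4 * expR (- t0) * expR (- t) by rewrite /A expRD mulrA.
have Ah : A * radial_amplitude t0 t ^+ 2 = 1.
  rewrite AE /radial_amplitude exprMn -expRM_natl.
  rewrite (_ : 2%:R * (2^-1 * (t + t0)) = t + t0); last by field.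
  rewrite expRD !expRN; field.
  by rewrite !gt_eqF ?expR_gt0.
have Aw : A * w = light_radius t0 t ^+ 2 - x ^+ 2.
  by rewrite /w /radial_variable /= mulrCA Ah mulr1.
have -> : (expR (- t0) + expR (- t)) ^+ 2 - x ^+ 2 = A * (1 + w).
  by rewrite mulrDr Aw mulr1 AE /light_radius; ring.
have -> : (expR (- t0) - expR (- t)) ^+ 2 - x ^+ 2 = A * w by rewrite Aw.
have -> : A * w / (A * (1 + w)) = w / (1 + w).
  by rewrite -mulf_div divff ?mul1r// gt_eqF.
rewrite hE//.
have -> : expR (- 2^-1 * ln A) = radial_amplitude t0 t.
  have h0 : 0 < radial_amplitude t0 t by rewrite mulr_gt0 ?expR_gt0.
  have -> : A = (radial_amplitude t0 t ^+ 2)^-1.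
    by rewrite -[RHS]mul1r -Ah mulfK// expf_neq0// gt_eqF.
  rewrite lnV ?posrE ?exprn_gt0// expr2 lnM ?posrE//.
  rewrite -[RHS](lnK h0); congr expR.
  by move: (ln _) => l; field.
by simpc.
Qed.

End HypergeometricKernel.

Theorem theorem0p1 (R : realType) (M t0 : R) (hM : 0 <= M) :
  [/\ loc_integrable (Eplus M 0 t0),
      fundamental_solution M (0, t0) (dist_of_fun (Eplus M 0 t0)),
      loc_integrable (Eminus M 0 t0) &
      fundamental_solution M (0, t0) (dist_of_fun (Eminus M 0 t0))].
Proof.
have [g [gi [pg pgi g0 gi0 /(E_radial (t0 := t0)) hE]]] := riemann_profile_hyp2F1 M.
have plusE z : Eplus M 0 t0 z =
    (radial t0 g \_ [set z : R * R | `|z.1| <= 1 * light_radius t0 z.2]) z +i*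
    (radial t0 gi \_ [set z : R * R | `|z.1| <= 1 * light_radius t0 z.2]) z.
  rewrite /Eplus !patchE (_ : Dplus 0 t0 = [set z : R * R | `|z.1| <= 1 * light_radius t0 z.2]).
    case: ifPn => // /set_mem /= zD; apply: hE; apply: le_trans zD _.
    by rewrite mul1r ler_norm.
  by apply/seteqP; split => y; rewrite /Dplus /= subr0 mul1r.
have minusE z : Eminus M 0 t0 z =
    (radial t0 g \_ [set z : R * R | `|z.1| <= -1 * light_radius t0 z.2]) z +i*
    (radial t0 gi \_ [set z : R * R | `|z.1| <= -1 * light_radius t0 z.2]) z.
  rewrite /Eminus !patchE (_ : Dminus 0 t0 = [set z : R * R | `|z.1| <= -1 * light_radius t0 z.2]).
    case: ifPn => // /set_mem /= zD; apply: hE; apply: le_trans zD _.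
    by rewrite mulN1r -normrN ler_norm.
  by apply/seteqP; split => y; rewrite /Dminus /= subr0 mulN1r.
have l1 : (1 : R) = 1 \/ (1 : R) = -1 by left.
have l2 : (-1 : R) = 1 \/ (-1 : R) = -1 by right.
split.
- exact: (cone_loc_integrable pg pgi plusE).
- exact: (cone_fundamental_solution l1 pg pgi g0 gi0 plusE).
- exact: (cone_loc_integrable pg pgi minusE).
- exact: (cone_fundamental_solution l2 pg pgi g0 gi0 minusE).
Qed.
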